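(* Let $\mathcal{H}$ be a complex Hilbert space and let $(\mathcal{T}_t)_{t\ge 0}$ be a uniformly continuous quantum dynamical semigroup on $\mathfrak{B}(\mathcal{H})$ of the form $\mathcal{T}_t(X)=\mathbb{E}_{0]}[U_t^\dagger(X\otimes \mathbb{1})U_t]$, with generator $\mathcal{L}$ and predual semigroup $\mathcal{S}_t$. Let $V\in\mathfrak{B}(\mathcal{H})$ be a self-adjoint operator such that for some neighborhood $\mathcal{N}\subseteq\mathfrak{S}(\mathcal{H})$, $\operatorname{tr}(\mathcal{L}(V)\rho)\le0$ for all $\rho\in\mathcal{N}$. Let $\mathcal{C}$ be a weakly compact subset of $\mathcal{N}$ that is invariant, and define $$\mathcal{E}=\{\rho\in\mathcal{C}:\operatorname{tr}(\mathcal{L}(V)\rho)=0\}.$$ Let $\mathcal{M}$ be the largest two-side invariant set in $\mathcal{E}$. Then for any $\rho\in\mathcal{C}$, $\mathcal{S}_t(\rho)$ converges weakly to the set $\mathcal{M}$ as $t\to\infty$; that is, for every $A\in\mathfrak{B}(\mathcal{H})$, $$\lim_{t\to\infty}\inf_{\sigma\in\mathcal{M}}\big|\operatorname{tr}\big((\mathcal{S}_t(\rho)-\sigma)A\big)\big|=0 .$$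
   Context: Notation. $\mathfrak{B}(\mathcal{H})$ is the algebra of bounded operators on $\mathcal{H}$; $\mathfrak{I}_1(\mathcal{H})$ is the space of trace-class operators with norm $\|X\|_1=\operatorname{tr}\sqrt{X^\ast X}$; $\mathfrak{S}(\mathcal{H})\subset \mathfrak{I}_1(\mathcal{H})$ is the set of density operators (non-negative, trace one). A neighborhood in $\mathfrak{S}(\mathcal{H})$ is a union of closed balls $\{\rho\in\mathfrak{S}(\mathcal{H}):\|\rho-\rho_0\|_1\le\epsilon\}$, $\epsilon>0$, $\rho_0\in\mathfrak{S}(\mathcal{H})$. The weak topology is $\sigma(\mathfrak{I}_1(\mathcal{H}),\mathfrak{B}(\mathcal{H}))$, the weakest topology making all functionals $\rho\mapsto\operatorname{tr}(\rho A)$, $A\in\mathfrak{B}(\mathcal{H})$, continuous. Quantum dynamical semigroup. A quantum dynamical semigroup (QDS) on $\mathfrak{B}(\mathcal{H})$ is a family of bounded linear maps $\mathcal{T}_t$, $t\ge 0$, with $\mathcal{T}_0=\mathrm{id}$, $\mathcal{T}_{s+t}=\mathcal{T}_s\circ\mathcal{T}_t$, each $\mathcal{T}_t$ completely positive and normally ($\sigma$-weakly) continuous. Here $U_t$ are the unitaries on $\mathcal{H}\otimes\Gamma$ describing the joint evolution of the system and an environment with Fock space $\Gamma$ in the state $\Psi\in\mathfrak{S}(\Gamma)$, and $\mathbb{E}_{0]}$ is the conditional expectation onto the system, so $\operatorname{tr}(\rho\,\mathbb{E}_{0]}[Z])=\operatorname{tr}((\rho\otimes\Psi)Z)$; in particular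 $\mathcal{T}_t(\mathbb{1})=\mathbb{1}$. The predual semigroup on $\mathfrak{I}_1(\mathcal{H})$ is $\mathcal{S}_t(\rho)=\operatorname{tr}_\Gamma(U_t(\rho\otimes\Psi)U_t^\dagger)$, and $\operatorname{tr}(\rho\,\mathcal{T}_t(X))=\operatorname{tr}(\mathcal{S}_t(\rho)X)$. Uniform continuity means norm continuity of $t\mapsto\mathcal{T}_t$, so the generator $\mathcal{L}(X)=\lim_{t\downarrow0}\frac1t(\mathcal{T}_t(X)-X)$ is bounded. Invariant sets. A set $\mathcal{M}$ of density operators is invariant if, for every $\rho\in\mathfrak{S}(\mathcal{H})$, $\mathcal{S}_t(\rho)\in\mathcal{M}$ for some $t\ge0$ implies $\mathcal{S}_{t'}(\rho)\in\mathcal{M}$ for all $t'\ge t$. It is two-side invariant if, for every $\rho\in\mathfrak{S}(\mathcal{H})$, $\mathcal{S}_t(\rho)\in\mathcal{M}$ for some $t\ge0$ implies $\mathcal{S}_{t'}(\rho)\in\mathcal{M}$ for all $t'\ge0$. *)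

(* Defs.v *)
From HB Require Import structures.
From mathcomp Require Import all_boot all_order all_algebra perm.
From mathcomp Require Import sesquilinear complex.
From mathcomp Require Import all_classical all_reals all_analysis.
From mathcomp Require Import summability.

Set Implicit Arguments.
Unset Strict Implicit.
Unset Printing Implicit Defensive.

Import Order.TTheory GRing.Theory Num.Theory.
Import numFieldNormedType.Exports.

Local Open Scope classical_set_scope.
Local Open Scope ring_scope.
Local Open Scope complex_scope.

(* The inner product is linear in its first and conjugate-linear in its
   second argument. *)
HB.mixin Record isHilbert (R : realType) H of CompleteNormedModule R[i] H := {
  hdot : {dot H for @conjc R};
  hdot_norm : forall x : H, hdot x x = `|x| ^+ 2
}.

#[short(type="hilbertType")]
HB.structure Definition Hilbert (R : realType) :=
  {H of isHilbert R H & CompleteNormedModule R[i] H}.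

Notation "'[ x , y ]" := (hdot x y) : ring_scope.

Section BoundedOperators.
Variables (R : realType) (E F : normedModType R[i]).

Definition is_bounded_op : {pred E -> F} := [pred f : E -> F | `[<
  linear f /\ exists M : R, forall x, `|f x| <= M%:C * `|x| >]].

Record bop := Bop { bop_fun :> E -> F; _ : is_bounded_op bop_fun }.

HB.instance Definition _ := [isSub for bop_fun].
HB.instance Definition _ := [Choice of bop by <:].

Lemma is_bounded_op_submod_closed : submod_closed is_bounded_op.
Proof.
split.
  apply/asboolP; split=> [a x y|]; first by rewrite /= scaler0 addr0.
  by exists 0 => x; rewrite mul0r normr0.
move=> a f g /asboolP[lf [M fM]] /asboolP[lg [N gN]]; apply/asboolP; split.
  move=> b x y; rewrite !fctE lf lg !scalerDr !scalerA [b * a]mulrC -!addrA.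
  by congr (_ + _); rewrite addrCA.
exists (complex.Re `|a| * M + N) => x.
have aE : (complex.Re `|a|)%:C = `|a| by rewrite RRe_real// normr_real.
rewrite rmorphD rmorphM /= aE mulrDl -mulrA.
rewrite (le_trans (ler_normD _ _))// lerD//.
by rewrite normrZ ler_wpM2l.
Qed.

HB.instance Definition _ :=
  GRing.isSubmodClosed.Build _ _ is_bounded_op is_bounded_op_submod_closed.
HB.instance Definition _ := [SubChoice_isSubLmodule of bop by <:].
End BoundedOperators.

Section OperatorNorm.
Variables (R : realType) (E F : normedModType R[i]).
Implicit Types f g : bop E F.

Lemma bop_linear f : linear f.
Proof. by have /asboolP[] := valP f. Qed.

Definition op_bounds f : set R :=
  [set M | 0 <= M /\ forall x, `|f x| <= M%:C * `|x|].

Definition opnorm f : R := inf (op_bounds f).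

Lemma op_bounds_has_inf f : has_inf (op_bounds f).
Proof.
split; last by exists 0 => M [].
have /asboolP[_ [M fM]] := valP f; exists `|M|; split=> // x.
apply: (le_trans (fM x)); rewrite ler_wpM2r// lecR.
exact: ler_norm.
Qed.

Lemma opnorm_ge0 f : 0 <= opnorm f.
Proof. by apply: lb_le_inf => [|M []//]; case: (op_bounds_has_inf f). Qed.

Lemma opnorm_min f M : op_bounds f M -> opnorm f <= M.
Proof. by move=> fM; apply: ge_inf => //; case: (op_bounds_has_inf f). Qed.

Lemma opnormP f x : `|f x| <= (opnorm f)%:C * `|x|.
Proof.
have [->|x0] := eqVneq x 0.
  have -> : f 0 = 0.
    by have := bop_linear f (-1) 0 0; rewrite scaler0 addr0 scaleN1r addNr.
  by rewrite !normr0 mulr0.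
rewrite -ler_pdivrMr ?normr_gt0//.
have cE (c : R[i]) : 0 <= c -> (complex.Re c)%:C = c.
  by move=> c0; rewrite RRe_real// ger0_real.
rewrite -[leLHS]cE ?divr_ge0// lecR; apply: lb_le_inf.
  by case: (op_bounds_has_inf f).
move=> M [_ fM]; rewrite -lecR cE ?divr_ge0//.
by rewrite ler_pdivrMr ?normr_gt0.
Qed.

Lemma opnormD f g :
  (opnorm (f + g))%:C <= (opnorm f)%:C + (opnorm g)%:C :> R[i].
Proof.
rewrite -rmorphD lecR; apply: opnorm_min; split=> [|x].
  by rewrite addr_ge0// opnorm_ge0.
rewrite rmorphD /= mulrDl (le_trans (ler_normD _ _))//.
by rewrite lerD// opnormP.
Qed.

Lemma opnorm_le_scale (a : R[i]) f :
  (opnorm (a *: f))%:C <= `|a| * (opnorm f)%:C.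
Proof.
have aE : (complex.Re `|a|)%:C = `|a| by rewrite RRe_real// normr_real.
rewrite -aE -rmorphM lecR; apply: opnorm_min; split=> [|x].
  rewrite mulr_ge0 ?opnorm_ge0//.
  by have := normr_ge0 a; rewrite -aE (lecR 0).
rewrite rmorphM /= aE -mulrA [`|_|]normrZ.
by rewrite ler_wpM2l// opnormP.
Qed.

Lemma opnormZ (a : R[i]) f : (opnorm (a *: f))%:C = `|a| * (opnorm f)%:C.
Proof.
apply/eqP; rewrite eq_le opnorm_le_scale /=.
have [->|a0] := eqVneq a 0.
  by rewrite normr0 mul0r lecR opnorm_ge0.
rewrite mulrC -ler_pdivlMr ?normr_gt0// mulrC -normfV.
by have := opnorm_le_scale a^-1 (a *: f); rewrite scalerA mulVf// scale1r.
Qed.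

Lemma opnorm_eq0 f : (opnorm f)%:C = 0 :> R[i] -> f = 0.
Proof.
move=> f0; apply/val_inj/funext => x; apply/eqP.
by rewrite -normr_le0 (le_trans (opnormP f x))// f0 mul0r.
Qed.

HB.instance Definition _ := Lmodule_isNormed.Build R[i] (bop E F)
  opnormD opnormZ opnorm_eq0.
End OperatorNorm.

Section OperatorAlgebra.
Variables (R : realType) (E : normedModType R[i]).
Implicit Types f g h : bop E E.

Lemma bop_id_subproof : is_bounded_op (@idfun E).
Proof. by apply/asboolP; split=> //; exists 1 => x; rewrite mul1r. Qed.

Lemma bop_comp_subproof f g : is_bounded_op (f \o g).
Proof.
apply/asboolP; split=> [a x y|] /=; first by rewrite !bop_linear.
exists (opnorm f * opnorm g) => x; rewrite rmorphM -mulrA.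
rewrite (le_trans (opnormP f _))// ler_wpM2l ?opnormP//.
by rewrite lecR opnorm_ge0.
Qed.

Definition bop_id : bop E E := Bop bop_id_subproof.
Definition bop_comp f g : bop E E := Bop (bop_comp_subproof f g).

Lemma bop_compA : associative bop_comp.
Proof. by move=> f g h; apply: val_inj. Qed.
Lemma bop_comp1f : left_id bop_id bop_comp.
Proof. by move=> f; apply: val_inj. Qed.
Lemma bop_compf1 : right_id bop_id bop_comp.
Proof. by move=> f; apply: val_inj. Qed.
Lemma bop_compDl : left_distributive bop_comp +%R.
Proof. by move=> f g h; apply: val_inj. Qed.
Lemma bop_compDr : right_distributive bop_comp +%R.
Proof.
move=> f g h; apply/val_inj/funext => x /=.
by have := bop_linear f 1 (g x) (h x); rewrite !scale1r.
Qed.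

HB.instance Definition _ := GRing.Zmodule_isPzRing.Build (bop E E)
  bop_compA bop_comp1f bop_compf1 bop_compDl bop_compDr.
End OperatorAlgebra.


Section HilbertSpaces.
Variable R : realType.
Implicit Types H K G : hilbertType R.

Definition lspan H (A : set H) : set H :=
  [set x | exists n (a : 'I_n -> R[i]) (v : 'I_n -> H),
    (forall i, A (v i)) /\ x = \sum_i a i *: v i].

Definition dense_span H (A : set H) : Prop := closure (lspan A) = [set: H].

Definition orthonormal_basis H (B : set H) : Prop :=
  (forall e f, B e -> B f -> '[e, f] = (e == f)%:R) /\ dense_span B.

(* Orthonormal bases exist by Zorn's lemma; the trace does not depend on the
   one that is picked. *)
Definition onb H : set H := xget set0 (@orthonormal_basis H).

(* [K] is the Hilbert space tensor product of [H] and [G]: product vectors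
   satisfy <x1 (x) y1, x2 (x) y2> = <x1, x2> <y1, y2> and span a dense subspace.
   This determines [K] up to a unitary compatible with product vectors, and it
   forces [tens] to be bilinear. *)
Record tensor_product H G K := TensorProduct {
  tens : H -> G -> K;
  tens_dot : forall x1 x2 y1 y2,
    '[tens x1 y1, tens x2 y2] = '[x1, x2] * '[y1, y2];
  tens_total : dense_span [set tens x y | x in [set: H] & y in [set: G]]
}.

(* [G] is the symmetric Fock space over the one-particle space [K], i.e. the
   Hilbert sum of the symmetric tensor powers of [K]: [fock_prod f] is the
   orthogonal projection of f_0 (x) ... (x) f_(n-1) on the symmetric tensors,
   and is the vacuum vector for n = 0. *)
Record fock_space K G := FockSpace {
  fock_prod : forall n, ('I_n -> K) -> G;
  fock_dot : forall n (f g : 'I_n -> K),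
    '[fock_prod f, fock_prod g] =
      (n`!%:R)^-1 * \sum_(s : 'S_n) \prod_(i < n) '[f i, g (s i)];
  fock_orth : forall m n (f : 'I_m -> K) (g : 'I_n -> K),
    m <> n -> '[fock_prod f, fock_prod g] = 0;
  fock_total : dense_span [set x | exists n (f : 'I_n -> K), x = fock_prod f]
}.

End HilbertSpaces.

Notation "''B' ( H )" := (bop H H) (format "''B' ( H )") : type_scope.

Section Operators.
Variables (R : realType) (H : hilbertType R).
Implicit Types X Y Q : 'B(H).

Definition adjoint X : 'B(H) :=
  xget 0 [set Y : 'B(H) | forall x y, '[X x, y] = '[x, Y y]].

Definition selfadjoint X : Prop := adjoint X = X.

Definition unitary_op X : Prop := adjoint X * X = 1 /\ X * adjoint X = 1.

(* In the order of [R[i]], [0 <= z] says that [z] is real and nonnegative. *)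
Definition positive_op X : Prop := forall x, 0 <= '[X x, x].

(* The positive square root of a positive operator. *)
Definition sqrtop X : 'B(H) := xget 0 [set Q : 'B(H) | positive_op Q /\ Q * Q = X].

Definition absop X : 'B(H) := sqrtop (adjoint X * X).

(* [sum] is the unordered sum (limit along finite sets of indices). *)
Definition tr X : R[i] :=
  sum ((fun e : H => '[X e, e] : R[i]^o) \_ (@onb R H)).

Definition tracenorm X : \bar R :=
  \esum_(e in @onb R H) (complex.Re '[absop X e, e])%:E.

Definition is_trace_class X : bool := `[< (tracenorm X < +oo)%E >].

Record traceclass := TraceClass {
  tc_op :> 'B(H); _ : is_trace_class tc_op }.

HB.instance Definition _ := [isSub for tc_op].
HB.instance Definition _ := [Choice of traceclass by <:].

Definition density : set traceclass := [set rho | positive_op rho /\ tr rho = 1].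

(* A union of closed trace-norm balls of density operators; [I] is the set of
   their (centre, radius) pairs. *)
Definition is_neighborhood (N : set traceclass) : Prop :=
  exists I : set (traceclass * R),
    (forall p, I p -> density p.1 /\ 0 < p.2) /\
    N = \bigcup_(p in I) [set rho | density rho /\
      (tracenorm (tc_op rho - tc_op p.1)%R <= p.2%:E)%E].

(* sigma(I_1(H), B(H)) *)
Definition weak_traceclass : Type :=
  initial_topology (fun rho : traceclass =>
    (fun A : 'B(H) => tr (tc_op rho * A)) : {ptws 'B(H) -> R[i]^o}).

(* sigma(B(H), I_1(H)) *)
Definition sigma_weak : Type :=
  initial_topology (fun X : 'B(H) =>
    (fun rho : traceclass => tr (tc_op rho * X)) : {ptws traceclass -> R[i]^o}).

HB.instance Definition _ := Topological.on weak_traceclass.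
HB.instance Definition _ := Topological.on sigma_weak.

Definition weakly_compact (C : set traceclass) : Prop :=
  compact (C : set weak_traceclass).

Definition normal_map (T : 'B(H) -> 'B(H)) : Prop :=
  continuous (T : sigma_weak -> sigma_weak).

(* Positivity of T (x) id_n on n x n operator matrices, for all n. *)
Definition completely_positive (T : 'B(H) -> 'B(H)) : Prop :=
  forall n (X : 'I_n -> 'I_n -> 'B(H)),
    (forall x : 'I_n -> H, 0 <= \sum_i \sum_j '[X i j (x j), x i]) ->
    (forall x : 'I_n -> H, 0 <= \sum_i \sum_j '[T (X i j) (x j), x i]).

(* Values at negative times are irrelevant. *)
Definition is_qds (T : R -> bop 'B(H) 'B(H)) : Prop :=
  [/\ T 0 = 1,
      forall s t, 0 <= s -> 0 <= t -> T (s + t) = T s * T t,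
      forall t, 0 <= t -> completely_positive (T t) &
      forall t, 0 <= t -> normal_map (T t)].

Definition uniformly_continuous_qds (T : R -> bop 'B(H) 'B(H)) : Prop :=
  {within `[0, +oo[, continuous T}.

Definition is_generator (T : R -> bop 'B(H) 'B(H)) (L : 'B(H) -> 'B(H)) : Prop :=
  forall X, (t^-1)%:C *: (T t X - X) @[t --> 0^'+] --> L X.

Definition is_predual
    (T : R -> bop 'B(H) 'B(H)) (S : R -> traceclass -> traceclass) : Prop :=
  forall t rho X, 0 <= t -> tr (tc_op rho * T t X) = tr (tc_op (S t rho) * X).

Section Invariance.
Variable S : R -> traceclass -> traceclass.

Definition invariant_set (M : set traceclass) : Prop :=
  M `<=` density /\
  forall rho t, density rho -> 0 <= t -> M (S t rho) ->
    forall t', t <= t' -> M (S t' rho).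

Definition two_side_invariant (M : set traceclass) : Prop :=
  M `<=` density /\
  forall rho t, density rho -> 0 <= t -> M (S t rho) ->
    forall t', 0 <= t' -> M (S t' rho).

Definition largest_two_side_invariant_in (E M : set traceclass) : Prop :=
  [/\ M `<=` E, two_side_invariant M &
      forall M', M' `<=` E -> two_side_invariant M' -> M' `<=` M].
End Invariance.

End Operators.

Section Dilation.
Variables (R : realType) (H G K : hilbertType R) (tp : tensor_product H G K).

(* The unique bounded operator with (X (x) Y)(x (x) y) = X x (x) Y y. *)
Definition tensop (X : 'B(H)) (Y : 'B(G)) : 'B(K) :=
  xget 0 [set Z : 'B(K) | forall x y, Z (tens tp x y) = tens tp (X x) (Y y)].

(* <tr_G(W) x, y> = \sum_k <W (x (x) k), y (x) k>, with k ranging over an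
   orthonormal basis of G. *)
Definition is_partial_trace (W : 'B(K)) (X : 'B(H)) : Prop :=
  forall x y, '[X x, y] =
    sum ((fun k : G => '[W (tens tp x k), tens tp y k] : R[i]^o) \_ (@onb R G)).

(* The conditional expectation onto the system for the environment state. *)
Definition is_cond_expectation (Psi : traceclass G) (E : 'B(K) -> 'B(H)) : Prop :=
  forall (rho : traceclass H) Z, tr (tc_op rho * E Z) = tr (tensop rho Psi * Z).

Definition is_dilation (U : R -> 'B(K)) (E : 'B(K) -> 'B(H))
    (T : R -> bop 'B(H) 'B(H)) : Prop :=
  forall t X, 0 <= t -> T t X = E (adjoint (U t) * tensop X 1 * U t).

Definition is_dilated_predual (U : R -> 'B(K)) (Psi : traceclass G)
    (S : R -> traceclass H -> traceclass H) : Prop :=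
  forall t (rho : traceclass H), 0 <= t ->
    is_partial_trace (U t * tensop rho Psi * adjoint (U t)) (S t rho).
End Dilation.

(* Main.v *)
(* LaSalle's argument on the omega-limit set Omega of the orbit t |-> S_t rho.
   The function t |-> tr (S_t rho V) is nonincreasing, because its right
   derivative is tr (S_t rho L(V)) <= 0, and it is bounded; hence tr (. V) is
   constant on Omega, and since Omega is forward invariant, tr (L(V) .) vanishes
   there. Weak compactness gives S_s Omega = Omega, and uniform continuity makes
   each S_s injective: a bounded functional that vanishes on the range of T_s is
   zero as soon as |1 - T_s| <= 1/2, and T_t is a power of such a T_s. So Omega
   is two-side invariant, is contained in M, and attracts the orbit.

   All traces that occur are of products of a density operator rho with a bounded
   operator. Their convergence follows from
   sum_e <rho X e, X e> <= |X|^2 tr rho, proved on finite sections with the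
   spectral theorem, without a square root of rho. *)
Require Import Defs.
From HB Require Import structures.
From mathcomp Require Import all_boot all_order all_algebra.
From mathcomp Require Import sesquilinear spectral complex.
From mathcomp Require Import all_classical all_reals all_analysis.
From mathcomp Require Import finmap summability ring.

Set Implicit Arguments.
Unset Strict Implicit.
Unset Printing Implicit Defensive.

Import Order.TTheory GRing.Theory Num.Theory.
Import numFieldNormedType.Exports.

Local Open Scope classical_set_scope.
Local Open Scope ring_scope.
Local Open Scope complex_scope.

#[local] Existing Instance totally_filter.

(** * Inner products and finite positive matrices *)

Section InnerProduct.
Variables (R : realType) (H : hilbertType R).
Implicit Types (x y z : H) (a : R[i]).

Lemma hdotDl x y z : '[x + y, z] = '[x, z] + '[y, z].
Proof. exact: linearDl. Qed.

Lemma hdotDr x y z : '[x, y + z] = '[x, y] + '[x, z].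
Proof. exact: linearDr. Qed.

Lemma hdotZl a x y : '[a *: x, y] = a * '[x, y].
Proof. exact: linearZl_LR. Qed.

Lemma hdotZr a x y : '[x, a *: y] = a^*%C * '[x, y].
Proof. exact: linearZr_LR. Qed.

Lemma hdotC x y : '[x, y] = ('[y, x])^*%C.
Proof. by have := hermC (@hdot R H) x y; rewrite /= expr0 mul1r. Qed.

Lemma hdot0l y : '[0, y] = 0. Proof. by rewrite -(scale0r 0) hdotZl mul0r. Qed.
Lemma hdot0r x : '[x, 0] = 0. Proof. by rewrite hdotC hdot0l conjc0. Qed.
Lemma hdotNl x y : '[- x, y] = - '[x, y].
Proof. by rewrite -scaleN1r hdotZl mulN1r. Qed.
Lemma hdotBl x y z : '[x - y, z] = '[x, z] - '[y, z].
Proof. by rewrite hdotDl hdotNl. Qed.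
Lemma hdotNr x y : '[x, - y] = - '[x, y].
Proof. by rewrite hdotC hdotNl rmorphN /= -hdotC. Qed.
Lemma hdotBr x y z : '[x, y - z] = '[x, y] - '[x, z].
Proof. by rewrite hdotDr hdotNr. Qed.

Lemma hdot_suml (I : Type) (r : seq I) (P : pred I) (F : I -> H) y :
  '[\sum_(i <- r | P i) F i, y] = \sum_(i <- r | P i) '[F i, y].
Proof.
elim/big_rec2: _ => [|i a x _ <-]; first by rewrite hdot0l.
by rewrite hdotDl.
Qed.

Lemma hdot_sumr (I : Type) (r : seq I) (P : pred I) (F : I -> H) x :
  '[x, \sum_(i <- r | P i) F i] = \sum_(i <- r | P i) '[x, F i].
Proof.
elim/big_rec2: _ => [|i a y _ <-]; first by rewrite hdot0r.
by rewrite hdotDr.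
Qed.

Lemma hdot_ge0 x : 0 <= '[x, x].
Proof. by rewrite hdot_norm exprn_ge0. Qed.

Lemma cauchy_schwarz x y : `|'[x, y]| <= `|x| * `|y|.
Proof.
have [->|y0] := eqVneq y 0; first by rewrite hdot0r !normr0 mulr0.
rewrite -(@ler_pXn2r _ 2) ?nnegrE ?mulr_ge0//.
(* This vector is the part of [x] orthogonal to [y], scaled by [|y| ^+ 2] to avoid a division; its
   square norm has [|y| ^+ 2] as a factor, which is cancelled. *)
have := hdot_ge0 (`|y| ^+ 2 *: x - '[x, y] *: y).
rewrite hdotBl !hdotBr !hdotZl !hdotZr !hdot_norm.
rewrite sqr_normc exprMn; set c := '[x, y]; rewrite (hdotC y x) -/c.
have -> : (`|y| ^+ 2)^*%C = `|y| ^+ 2.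
  by rewrite -[ `|y| ]RRe_real ?normr_real// -rmorphXn conjc_real.
have p0 : 0 < `|y| ^+ 2 by rewrite exprn_gt0// normr_gt0.
set p := `|y| ^+ 2 in p0 *; set q := `|x| ^+ 2.
have -> : p * (p * q) - p * (c^* * c) - (c * (p * c^*) - c * (c^* * p)) =
  p * (p * q - c * c^*) by ring.
by rewrite pmulr_rge0// subr_ge0 [p * q]mulrC.
Qed.

Lemma hdot_inj x y : (forall z, '[x, z] = '[y, z]) -> x = y.
Proof.
move=> xy; apply/eqP; rewrite -subr_eq0 -normr_eq0 -sqrf_eq0.
by rewrite -hdot_norm hdotBl xy subrr.
Qed.

End InnerProduct.

Section PositiveMatrix.
Variable R : realType.
Local Notation C := R[i].

Lemma conjCc (z : C) : z^*%R = z^*%C.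
Proof. by []. Qed.

(** The left side is the trace of [M] compressed by [y], and the last hypothesis says that [y] has
    squared operator norm at most [K]. Diagonalising [M] turns both sides into sums weighted by its
    nonnegative eigenvalues, and the hypothesis is applied to each eigenvector. *)
Lemma psd_trace_bound_ord n (J : finType) (M : 'I_n -> 'I_n -> C)
    (y : J -> 'I_n -> C) (K : C) :
  (forall i j, M j i = (M i j)^*%C) ->
  (forall c : 'I_n -> C, 0 <= \sum_i \sum_j c i * (c j)^*%C * M i j) ->
  (forall v : 'I_n -> C,
    \sum_a `|\sum_i y a i * (v i)^*%C| ^+ 2 <= K * \sum_i `|v i| ^+ 2) ->
  \sum_a \sum_i \sum_j y a i * (y a j)^*%C * M i j <= K * \sum_i M i i.
Proof.
move=> Mherm Mpos yK.
pose A := \matrix_(i, j) M i j.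
have Aherm : A \is hermsymmx.
  apply/is_hermitianmxP; rewrite expr0 scale1r; apply/matrixP => i j.
  by rewrite !mxE conjCc -Mherm.
have /orthomx_spectralP AE := hermitian_normalmx Aherm.
have uP := spectral_unitarymx A.
set P := spectralmx A in AE uP; set d := spectral_diag A in AE.
have AE' : diag_mx d = P *m A *m P ^t*%sesqui.
  by rewrite [in RHS]AE !mulmxA mulmxV ?mul1mx ?mulmxtVK// unitarymx_unit.
have dE k : d 0 k = \sum_i \sum_j P k i * (P k j)^*%C * M i j.
  have /matrixP/(_ k k) := AE'; rewrite !mxE eqxx mulr1n => ->.
  rewrite exchange_big/=; apply: eq_bigr => j _; rewrite !mxE mulr_suml.
  by apply: eq_bigr => i _; rewrite !mxE conjCc mulrAC.
(* Each eigenvalue is the quadratic form of [M] at a row of [P]. *)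
have d0 k : 0 <= d 0 k by rewrite dE; exact: Mpos.
have ME i j : M i j = \sum_k d 0 k * ((P k i)^*%C * P k j).
  have /matrixP/(_ i j) := AE; rewrite mxE => ->.
  rewrite mxE; apply: eq_bigr => k _.
  by rewrite invmx_unitary// mul_mx_diag !mxE conjCc mulrC mulrCA mulrA mulrC.
have -> : \sum_a \sum_i \sum_j y a i * (y a j)^*%C * M i j =
    \sum_k d 0 k * \sum_a `|\sum_i y a i * (P k i)^*%C| ^+ 2.
  under [RHS]eq_bigr do rewrite mulr_sumr.
  rewrite [RHS]exchange_big /=; apply: eq_bigr => a _.
  have sqE k : d 0 k * `|\sum_i y a i * (P k i)^*%C| ^+ 2 =
      \sum_i \sum_j d 0 k * (y a i * (P k i)^*%C * (y a j * (P k j)^*%C)^*%C).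
    rewrite sqr_normc rmorph_sum /= mulr_suml mulr_sumr.
    by apply: eq_bigr => i _; rewrite mulr_sumr mulr_sumr.
  under [RHS]eq_bigr do rewrite sqE.
  rewrite [RHS]exchange_big /=; apply: eq_bigr => i _.
  rewrite [RHS]exchange_big /=; apply: eq_bigr => j _.
  rewrite ME mulr_sumr; apply: eq_bigr => k _.
  by rewrite rmorphM /= conjcK; ring.
have -> : K * \sum_i M i i = \sum_k d 0 k * (K * \sum_i `|P k i| ^+ 2).
  under [RHS]eq_bigr do rewrite mulrCA.
  rewrite -mulr_sumr; congr (_ * _).
  under [RHS]eq_bigr do rewrite mulr_sumr.
  rewrite [RHS]exchange_big /=; apply: eq_bigr => i _.
  by rewrite ME; apply: eq_bigr => k _; rewrite sqr_normc [P k i * _]mulrC.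
by apply: ler_sum => k _; rewrite ler_wpM2l.
Qed.

(** Transport along [enum_val], so that the bound applies to matrices indexed by finite subsets of a
    basis. *)
Lemma psd_trace_bound (I J : finType) (M : I -> I -> C)
    (y : J -> I -> C) (K : C) :
  (forall i j, M j i = (M i j)^*%C) ->
  (forall c : I -> C, 0 <= \sum_i \sum_j c i * (c j)^*%C * M i j) ->
  (forall v : I -> C,
    \sum_a `|\sum_i y a i * (v i)^*%C| ^+ 2 <= K * \sum_i `|v i| ^+ 2) ->
  \sum_a \sum_i \sum_j y a i * (y a j)^*%C * M i j <= K * \sum_i M i i.
Proof.
have sumE (F : I -> C) : \sum_i F i = \sum_(k < #|I|) F (enum_val k).
  rewrite (reindex (enum_val : 'I_#|I| -> I))//=.
  by exists enum_rank => i _; [exact: enum_valK|exact: enum_rankK].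
move=> Mherm Mpos yK.
under eq_bigr => a _ do (rewrite sumE; under eq_bigr do rewrite sumE).
rewrite sumE.
apply: (@psd_trace_bound_ord _ _ (fun i j => M (enum_val i) (enum_val j))
  (fun a i => y a (enum_val i))) => [i j|c|v]; first exact: Mherm.
  have := Mpos (c \o enum_rank); rewrite sumE.
  under eq_bigr do rewrite sumE.
  by under eq_bigr do under eq_bigr do rewrite /= !enum_valK.
have := yK (v \o enum_rank); rewrite sumE.
under eq_bigr do rewrite sumE.
under eq_bigr do under eq_bigr do rewrite /= enum_valK.
by under [X in _ <= _ * X]eq_bigr do rewrite /= enum_valK.
Qed.

End PositiveMatrix.

(** * Complex limits and unordered sums *)

Section ComplexLimits.
Variable R : realType.
Local Notation C := R[i].
Variables (T : Type) (F : set_system T).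

Lemma cvg_Re {FF : Filter F} (f : T -> C^o) (l : C) :
  f @ F --> (l : C^o) -> complex.Re (f x) @[x --> F] --> complex.Re l.
Proof.
move=> /cvgrPdist_lt fl; apply/cvgrPdist_lt => e e0.
have {}e0 : 0 < e%:C by rewrite ltcR.
apply: filterS (fl _ e0) => x; rewrite -ltcR -raddfB; apply: le_lt_trans.
exact: normc_ge_Re.
Qed.

Lemma cvg_Im {FF : Filter F} (f : T -> C^o) (l : C) :
  f @ F --> (l : C^o) -> complex.Im (f x) @[x --> F] --> complex.Im l.
Proof.
move=> fl; have iE (z : C) : complex.Im z = - complex.Re (z * 'i%C).
  by rewrite ReiNIm opprK.
rewrite iE; under eq_cvg do rewrite iE.
by apply: cvgN; apply: cvg_Re; apply: cvgMl.
Qed.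

Lemma cvg_complex {FF : Filter F} (f : T -> C^o) (l : C) :
  complex.Re (f x) @[x --> F] --> complex.Re l ->
  complex.Im (f x) @[x --> F] --> complex.Im l -> f @ F --> (l : C^o).
Proof.
move=> /cvgrPdist_lt fR /cvgrPdist_lt fI; apply/cvgrPdist_lt => e e0.
have eE : (complex.Re e)%:C = e by rewrite RRe_real// gtr0_real.
have e20 : 0 < complex.Re e / 2 by rewrite divr_gt0// -ltcR eE.
near=> x; rewrite -eE [complex.Re e]splitr rmorphD /=.
rewrite [_ - _]complexE (le_lt_trans (ler_normD _ _))//.
have nr (r : R) : `|r%:C| = `|r|%:C :> C.
  by rewrite normc_def /= expr0n addr0 sqrtr_sqr.
rewrite normrM nr normc_def /= expr0n expr1n add0r sqrtr1 mul1r nr.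
rewrite !raddfB ltrD// ltcR; near: x; [exact: fR|exact: fI].
Unshelve. all: by end_near. Qed.

(** Being nonnegative in [C] includes being real, so the limit of the imaginary parts must also be
    identified as zero. *)
Lemma cvg_ge0C {FF : ProperFilter F} (f : T -> C^o) (l : C) :
  (\forall x \near F, 0 <= f x) -> f @ F --> (l : C^o) -> 0 <= l.
Proof.
move=> f0 fl; rewrite lecE /=; apply/andP; split; last first.
  apply: (cvgr_to_ge (cvg_Re fl)); apply: filterS f0 => x.
  by rewrite lecE => /andP[].
apply/eqP; have fI : complex.Im (f x) @[x --> F] --> complex.Im l by exact: cvg_Im.
suff : complex.Im (f x) @[x --> F] --> (0 : R).
  by move=> f0'; exact: (cvg_unique (@norm_hausdorff _ R^o) fI f0').
apply: cvg_near_cst; apply: filterS f0 => x.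
by rewrite lecE => /andP[/eqP].
Qed.

Lemma cvg_le_norm {FF : ProperFilter F} (f : T -> C^o) (l K : C) :
  (\forall x \near F, `|f x| <= K) -> f @ F --> (l : C^o) -> `|l| <= K.
Proof.
move=> fK fl; rewrite -subr_ge0; apply: (@cvg_ge0C _ (fun x => K - `|f x|)).
  by apply: filterS fK => x; rewrite subr_ge0.
apply: (@cvgB _ C^o); [exact: cvg_cst|exact: cvg_norm].
Qed.

End ComplexLimits.

Section UnorderedSums.
Variables (I : choiceType).

Lemma partial_sumE (V : zmodType) (f : I -> V) (A : {fset I}) :
  partial_sum f A = \sum_(i <- A) f i.
Proof. by rewrite /partial_sum big_seq_fsetE. Qed.

Lemma ler_partial_sum (R : numDomainType) (f : I -> R) (A B : {fset I}) :
  (forall i, 0 <= f i) -> (A `<=` B)%fset -> partial_sum f A <= partial_sum f B.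
Proof.
move=> f0 AB; rewrite !partial_sumE [leRHS](big_fsetID _ (mem A))/=.
rewrite [X in X + _](_ : _ = \sum_(i <- A) f i) ?lerDl ?sumr_ge0//.
by apply: eq_fbigl => i; rewrite !inE; apply/andb_idl; exact: (fsubsetP AB).
Qed.

Variable R : realType.

Lemma nneg_bounded_sum (f : I -> R) (K : R) : (forall i, 0 <= f i) ->
  (forall A, partial_sum f A <= K) -> exists l : R, partial_sum f @ totally --> l.
Proof.
move=> f0 fK; pose P := range (partial_sum f).
have supP : has_sup P.
  split; first by exists (partial_sum f fset0), fset0.
  by exists K => _ [A _ <-].
exists (sup P); apply/cvgrPdist_lt => e e0.
have [_ [A _ <-] Ae] := sup_adherent e0 supP.
exists A => // B AB; rewrite ger0_norm ?subr_ge0; last first.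
  by apply: ub_le_sup; [case: supP|exists B].
by rewrite ltrBlDr -ltrBlDl (lt_le_trans Ae)// ler_partial_sum.
Qed.

Local Notation C := R[i].

(** If [h] is the real or imaginary part of [f], then [h + g] with [g = |f|] has nonnegative terms
    and partial sums at most [K + K], so it is summable; subtracting the sum of [g] leaves that of
    [h]. *)
Lemma abs_bounded_sum (f : I -> C^o) (K : R) :
  (forall A, partial_sum (fun i => `|f i|) A <= K%:C) ->
  exists2 l : C, partial_sum f @ totally --> (l : C^o) & `|l| <= K%:C.
Proof.
move=> fK; pose g i := complex.Re `|f i|.
have gE i : (g i)%:C = `|f i| by rewrite RRe_real// normr_real.
have g0 i : 0 <= g i by rewrite -ler0c gE.
have psC (h : I -> R) A : (partial_sum h A)%:C = partial_sum (fun i => (h i)%:C) A.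
  by rewrite /partial_sum rmorph_sum.
have psD (h1 h2 : I -> R) A :
    partial_sum (fun i => h1 i + h2 i) A = partial_sum h1 A + partial_sum h2 A.
  by rewrite /partial_sum big_split.
have gK A : partial_sum g A <= K.
  by rewrite -lecR psC (le_trans _ (fK A))// /partial_sum ler_sum// => i _; rewrite gE.
have [lg cg] := nneg_bounded_sum g0 gK.
have part (h : I -> R) : (forall i, `|h i| <= g i) ->
    exists l : R, partial_sum h @ totally --> l.
  move=> hg; have hg0 i : 0 <= h i + g i.
    by rewrite -lerBlDr sub0r; have := hg i; rewrite ler_norml => /andP[].
  have hgK A : partial_sum (fun i => h i + g i) A <= K + K.
    rewrite psD lerD// (le_trans _ (gK A))// ler_sum// => i _.
    exact: le_trans (ler_norm _) (hg _).
  have [l cl] := nneg_bounded_sum hg0 hgK.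
  exists (l - lg); rewrite (_ : partial_sum h =
    (fun A => partial_sum (fun i => h i + g i) A - partial_sum g A)); last first.
    by apply/funext => A; rewrite psD addrK.
  exact: cvgB.
have [a ca] : exists l : R, partial_sum (fun i => complex.Re (f i)) @ totally --> l.
  by apply: part => i; rewrite -lecR gE normc_ge_Re.
have [b cb] : exists l : R, partial_sum (fun i => complex.Im (f i)) @ totally --> l.
  apply: part => i; rewrite -lecR gE -[X in X%:C]normrN -ReiNIm.
  rewrite (le_trans (normc_ge_Re _))// normrM [X in _ * X](_ : _ = 1) ?mulr1//.
  by rewrite normc_def /= expr0n expr1n add0r sqrtr1.
have cf : partial_sum f @ totally --> (a +i* b : C^o).
  apply: cvg_complex; rewrite /partial_sum /=.
  - rewrite (_ : (fun x => _) = partial_sum (fun i => complex.Re (f i)))//.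
    by apply/funext => A; rewrite /partial_sum raddf_sum.
  - rewrite (_ : (fun x => _) = partial_sum (fun i => complex.Im (f i)))//.
    by apply/funext => A; rewrite /partial_sum raddf_sum.
exists (a +i* b) => //; apply: (cvg_le_norm _ cf).
apply: nearW => A; apply: le_trans (fK A); exact: ler_norm_sum.
Qed.

End UnorderedSums.

(** * Bounded operators and the trace *)

HB.instance Definition _ (R : realType) (E F : normedModType R[i]) (f : bop E F) :=
  GRing.isLinear.Build R[i] E F *:%R f (bop_linear f).

Section BopLinear.
Variables (R : realType) (E F : normedModType R[i]) (f : bop E F).

Lemma bopD x y : f (x + y) = f x + f y. Proof. exact: linearD. Qed.
Lemma bopB x y : f (x - y) = f x - f y. Proof. exact: linearB. Qed.
Lemma bopZ a x : f (a *: x) = a *: f x. Proof. exact: linearZ. Qed.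
Lemma bop0 : f 0 = 0. Proof. exact: linear0. Qed.
Lemma bop_sum (I : Type) (r : seq I) (P : pred I) (v : I -> E) :
  f (\sum_(i <- r | P i) v i) = \sum_(i <- r | P i) f (v i).
Proof. exact: linear_sum. Qed.

Lemma bop_continuous : continuous f.
Proof.
move=> x; apply/cvgrPdist_lt => e e0.
have c0 : 0 < (opnorm f)%:C + 1 :> R[i] by rewrite ltr_wpDl// ler0c opnorm_ge0.
near=> y; rewrite -bopB (le_lt_trans (opnormP _ _))//.
rewrite (@le_lt_trans _ _ (((opnorm f)%:C + 1) * `|x - y|))//.
  by rewrite ler_wpM2r// lerDl.
rewrite mulrC -ltr_pdivlMr//.
by near: y; apply: cvgr_dist_lt => //; exact: divr_gt0.
Unshelve. all: by end_near. Qed.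

End BopLinear.

(** * Positive operators: symmetry and an arithmetic-geometric mean bound *)

Section PositiveOperators.
Variables (R : realType) (H : hilbertType R).
Implicit Types (x y z : H) (rho : 'B(H)).

(** Polarization: the quadratic form is real at [x + y] and at [x + j *: y], where [j] is the
    imaginary unit, and these two conditions determine the conjugates of the cross terms. *)
Lemma positive_hermitian rho x y :
  positive_op rho -> '[rho x, y] = '[x, rho y].
Proof.
move=> rho0; pose B u v := '[rho u, v].
have realB u : (B u u)^*%C = B u u.
  by rewrite -[B u u]RRe_real ?ger0_real ?rho0// conjc_real.
have BD u v w : B (u + v) w = B u w + B v w by rewrite /B bopD hdotDl.
have BDr u v w : B w (u + v) = B w u + B w v by rewrite /B hdotDr.
have BZ a u v : B (a *: u) v = a * B u v by rewrite /B bopZ hdotZl.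
have BZr a u v : B u (a *: v) = a^*%C * B u v by rewrite /B hdotZr.
have [j jC j2] : exists2 j : R[i], j^*%C = - j & j * j = -1.
  exists 'i%C; last by rewrite -expr2 sqr_i.
  by apply/eqP; rewrite eq_complex /= oppr0 !eqxx.
have H1 := realB (x + y); have H2 := realB (x + j *: y).
have xx := realB x; have yy := realB y.
rewrite [RHS]hdotC -/(B x y) -/(B y x).
rewrite !(BD, BDr, BZ, BZr) !rmorphD !rmorphM /= ?conjcK in H1 H2.
rewrite xx yy jC in H1 H2.
set p := B x y in H1 H2 *; set q := B y x in H1 H2 *.
set p' := p^*%C in H1 H2 *; set q' := q^*%C in H1 H2 *.
move: (B x x) (B y y) p q p' q' H1 H2 {xx yy realB BD BDr BZ BZr} => a b p q p' q' H1 H2.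
have E1 : p' + q' = p + q.
  apply: (addrI (a + b)).
  transitivity (a + p' + (q' + b)); first by ring.
  by rewrite H1; ring.
have E2 : q' - p' = p - q.
  transitivity (j * (j * (p' - q'))); first by rewrite mulrA j2; ring.
  transitivity (j * (j * (q - p))); last by rewrite mulrA j2; ring.
  congr (_ * _).
  apply: (addrI (a - j * (j * b))).
  transitivity (a + j * p' + (- j * q' + - j * (j * b))); first by ring.
  by rewrite H2; ring.
apply: (@mulfI _ 2); first by rewrite pnatr_eq0.
transitivity ((p + q) + (p - q)); first by ring.
by rewrite -E1 -E2; ring.
Qed.

Lemma positive_amgm rho x y : positive_op rho ->
  2 * `|'[rho x, y]| <= '[rho x, x] + '[rho y, y].
Proof.
move=> rho0; have [->|c0] := eqVneq '[rho x, y] 0.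
  by rewrite normr0 mulr0 addr_ge0.
(* The phase [d] rotates [y] so that both cross terms of the form at [x - d *: y] become minus the
   modulus of [c]. *)
set c := '[rho x, y] in c0 *; pose d := c / `|c|.
have n0 : `|c| != 0 by rewrite normr_eq0.
have nC : `|c|^*%C = `|c| by rewrite -[ `|c|]RRe_real ?normr_real// conjc_real.
have dd : d * d^*%C = 1.
  by rewrite -sqr_normc /d normrM normfV normr_id mulfV// expr1n.
have dC : d * c^*%C = `|c|.
  by rewrite /d mulrAC -sqr_normc expr2 mulfK.
have dc : d^*%C * c = `|c|.
  by rewrite -[c in LHS]conjcK -(rmorphM (@conjc R)) dC; exact: nC.
have := rho0 (x - d *: y).
rewrite bopB bopZ hdotBl !hdotBr !hdotZl !hdotZr -/c.
have -> : '[rho y, x] = c^*%C by rewrite positive_hermitian// hdotC.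
rewrite dc dC mulrA dd mul1r.
have -> : '[rho x, x] - `|c| - (`|c| - '[rho y, y]) =
  '[rho x, x] + '[rho y, y] - 2 * `|c| by ring.
by rewrite subr_ge0.
Qed.

End PositiveOperators.

Lemma cvg_hdot (R : realType) (H : hilbertType R) (T : Type) (F : set_system T)
    {FF : Filter F} (f g : T -> H) (x y : H) :
  f @ F --> x -> g @ F --> y ->
  ('[f t, g t] : R[i]^o) @[t --> F] --> ('[x, y] : R[i]^o).
Proof.
move=> /cvgrPdist_lt fx /cvgrPdist_lt gy; apply/cvgrPdist_lt => e e0.
have y0 : 0 < `|y| + 1 by rewrite ltr_wpDl.
have x0 : 0 < `|x| + 1 by rewrite ltr_wpDl.
have e20 : 0 < e / 2 by rewrite divr_gt0.
have ey : 0 < e / 2 / (`|y| + 1) by rewrite divr_gt0.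
have ex : 0 < e / 2 / (`|x| + 1) by rewrite divr_gt0.
apply: filterS3 (fx _ ey) (gy _ ex) (gy _ ltr01) => t xt yt yt1.
have -> : '[x, y] - '[f t, g t] = '[x - f t, g t] + '[x, y - g t].
  by rewrite hdotBl hdotBr [RHS]addrC subrKA.
have gt : `|g t| <= `|y| + 1.
  rewrite -[g t](subKr y) (le_trans (ler_normB _ _))// lerD2l.
  by rewrite ltW.
rewrite (le_lt_trans (ler_normD _ _))// [ltRHS]splitr ltrD//.
  rewrite (le_lt_trans (cauchy_schwarz _ _))//.
  by rewrite (le_lt_trans (ler_wpM2l _ gt))// -ltr_pdivlMr.
rewrite (le_lt_trans (cauchy_schwarz _ _))//.
rewrite (@le_lt_trans _ _ ((`|x| + 1) * `|y - g t|))//.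
  by rewrite ler_wpM2r// lerDl.
by rewrite mulrC -ltr_pdivlMr.
Qed.

(** * Parseval, Bessel and trace bounds along an orthonormal family *)

Section ParsevalFamily.
Variables (R : realType) (H : hilbertType R) (I : choiceType) (b : I -> H).
Local Notation C := R[i].
Implicit Types (A B : {fset I}) (u v w x y : H) (rho X : 'B(H)).

(* A zero-padded orthonormal basis: each [b i] is a unit vector or zero. *)
Hypothesis b_orth : forall i j, i != j -> '[b i, b j] = 0.
Hypothesis b_unit : forall i, '[b i, b i] *: b i = b i.
Hypothesis b_total : forall u (e : C), 0 < e ->
  exists n (a : 'I_n -> C) (k : 'I_n -> I), `|u - \sum_i a i *: b (k i)| < e.

Lemma family_norm_le1 i : '[b i, b i] <= 1.
Proof.
have [bi0|bi0] := eqVneq (b i) 0; first by rewrite bi0 hdot0l.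
rewrite (_ : '[b i, b i] = 1)//; apply/eqP; rewrite -subr_eq0.
have : ('[b i, b i] - 1) *: b i = 0 by rewrite scalerBl b_unit scale1r subrr.
by move/eqP; rewrite scaler_eq0 (negPf bi0) orbF.
Qed.

Lemma norm_family_sum A (c : A -> C) :
  `|\sum_(i : A) c i *: b (val i)| ^+ 2 <= \sum_(i : A) `|c i| ^+ 2.
Proof.
rewrite -hdot_norm hdot_suml; apply: ler_sum => i _.
rewrite hdotZl hdot_sumr (bigD1 i)//= big1 ?addr0; last first.
  by move=> j ji; rewrite hdotZr b_orth ?mulr0// eq_sym (inj_eq val_inj).
rewrite hdotZr mulrA -sqr_normc -[leRHS]mulr1 ler_wpM2l ?exprn_ge0//.
exact: family_norm_le1.
Qed.

Definition proj A u : H := \sum_(i : A) '[u, b (val i)] *: b (val i).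

Lemma hdot_proj A u i : i \in A -> '[proj A u, b i] = '[u, b i].
Proof.
move=> iA; rewrite /proj hdot_suml (bigD1 [` iA]%fset)//= big1 ?addr0.
  rewrite hdotZl -[in RHS]b_unit hdotZr mulrC; congr (_ * _).
  exact: hdotC.
by move=> j ji; rewrite hdotZl b_orth ?mulr0.
Qed.

(** The residual [z] is orthogonal to [proj A u] and to [w], so its square norm is the inner product
    of [z] with [u - w]; Cauchy-Schwarz concludes. *)
Lemma proj_best A u n (a : 'I_n -> C) (k : 'I_n -> I) :
  (forall j, k j \in A) ->
  `|u - proj A u| <= `|u - \sum_j a j *: b (k j)|.
Proof.
move=> kA; set w := \sum_j _; set z := u - _.
have zb i : i \in A -> '[z, b i] = 0.
  by move=> iA; rewrite hdotBl hdot_proj// subrr.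
have zw : '[z, w] = 0.
  by rewrite hdot_sumr big1// => j _; rewrite hdotZr zb ?mulr0.
have zp : '[z, proj A u] = 0.
  by rewrite hdot_sumr big1// => j _; rewrite hdotZr zb ?mulr0// fsvalP.
have [->|z0] := eqVneq z 0; first by rewrite normr0.
have zz : '[z, z] = '[z, u - w].
  by rewrite hdotBr zw {2}/z hdotBr zp.
rewrite -(ler_pM2l (x := `|z|)) ?normr_gt0// -expr2 -hdot_norm.
rewrite (le_trans _ (cauchy_schwarz _ _))// zz real_ler_norm//.
by rewrite -zz ger0_real// hdot_ge0.
Qed.

(** Totality gives one finite combination close to [u]; by best approximation, every finite set
    containing its indices does at least as well. *)
Lemma proj_cvg u : proj^~ u @ totally --> u.
Proof.
apply/cvgrPdist_lt => e e0; have [n [a [k ue]]] := b_total u e0.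
exists [fset k j | j in 'I_n]%fset => // A kA; apply: le_lt_trans ue.
by apply: proj_best => j; apply: (fsubsetP kA); apply/imfsetP; exists j.
Qed.

Lemma parseval u v :
  partial_sum (fun i => '[u, b i] * '[b i, v] : C^o) @ totally --> ('[u, v] : C^o).
Proof.
rewrite (_ : partial_sum _ = fun A => '[proj A u, v]); last first.
  apply/funext => A; rewrite /partial_sum /proj hdot_suml.
  by apply: eq_bigr => i _; rewrite hdotZl.
by apply: cvg_hdot; [exact: proj_cvg|exact: cvg_cst].
Qed.

(** Bessel's inequality for the adjoint of [X] at [w], obtained without forming the adjoint: the sum
    [s] is the inner product of [X z] and [w] for a combination [z] with square norm at most [s], so
    [s ^+ 2] is at most [s] times the bound. *)
Lemma bessel_image X A w :
  \sum_(i : A) `|'[X (b (val i)), w]| ^+ 2 <= ((opnorm X) ^+ 2)%:C * `|w| ^+ 2.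
Proof.
set s := \sum_i _; pose z := \sum_(i : A) ('[X (b (val i)), w])^*%C *: b (val i).
have s0 : 0 <= s by apply: sumr_ge0 => i _; rewrite exprn_ge0.
have zs : `|z| ^+ 2 <= s.
  apply: le_trans (norm_family_sum _) _.
  by apply: ler_sum => i _; rewrite normcJ.
have sE : s = '[X z, w].
  rewrite bop_sum hdot_suml; apply: eq_bigr => i _.
  by rewrite bopZ hdotZl sqr_normc mulrC.
have sle : s <= (opnorm X)%:C * `|z| * `|w|.
  rewrite -[s]ger0_norm// sE (le_trans (cauchy_schwarz _ _))//.
  by rewrite ler_wpM2r// opnormP.
have [->|sn0] := eqVneq s 0.
  by rewrite mulr_ge0 ?exprn_ge0// ler0c exprn_ge0// opnorm_ge0.
have sgt0 : 0 < s by rewrite lt_def sn0.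
rewrite -(ler_pM2l sgt0) -expr2.
apply: (@le_trans _ _ (((opnorm X)%:C * `|z| * `|w|) ^+ 2)).
  by rewrite ler_pXn2r ?nnegrE// !mulr_ge0// ler0c opnorm_ge0.
rewrite !exprMn rmorphXn mulrAC [leRHS]mulrC ler_wpM2l//.
by rewrite mulr_ge0// exprn_ge0// ler0c opnorm_ge0.
Qed.

Section TraceBound.
Variables (rho : 'B(H)) (K : R).
Hypothesis rho0 : positive_op rho.
Hypothesis rhoK : forall A, partial_sum (fun i => '[rho (b i), b i]) A <= K%:C.

(** Replacing each [X (b i)] by its projection on a finite section [G] gives the matrix situation of
    [psd_trace_bound], with constant [opnorm X ^+ 2] from [bessel_image]. The bound does not depend
    on [G], so it survives the limit. *)
Lemma diag_image_bound X A :
  partial_sum (fun i => '[rho (X (b i)), X (b i)]) A <= ((opnorm X) ^+ 2 * K)%:C.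
Proof.
pose f (G : {fset I}) :=
  \sum_(i : A) '[rho (proj G (X (b (val i)))), proj G (X (b (val i)))].
have fK G : f G <= ((opnorm X) ^+ 2 * K)%:C.
  have -> : f G = \sum_(a : A) \sum_(i : G) \sum_(j : G)
      '[X (b (val a)), b (val i)] * ('[X (b (val a)), b (val j)])^*%C *
      '[rho (b (val i)), b (val j)].
    apply: eq_bigr => a _; rewrite {1}/proj bop_sum hdot_suml.
    apply: eq_bigr => i _; rewrite bopZ hdotZl hdot_sumr mulr_sumr.
    by apply: eq_bigr => j _; rewrite hdotZr mulrA.
  rewrite rmorphM (le_trans _ (ler_wpM2l _ (rhoK G)))//; last first.
    by rewrite ler0c exprn_ge0// opnorm_ge0.
  apply: (@psd_trace_bound R G A (fun i j => '[rho (b (val i)), b (val j)])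
    (fun a i => '[X (b (val a)), b (val i)])) => [i j|c|v].
  - by rewrite positive_hermitian// hdotC.
  - rewrite (_ : \sum_i _ =
        '[rho (\sum_i c i *: b (val i)), \sum_i c i *: b (val i)])//.
    rewrite bop_sum hdot_suml; apply: eq_bigr => i _.
    rewrite bopZ hdotZl hdot_sumr mulr_sumr; apply: eq_bigr => j _.
    by rewrite hdotZr mulrA.
  - pose w := \sum_i v i *: b (val i).
    rewrite (_ : \sum_a _ = \sum_(a : A) `|'[X (b (val a)), w]| ^+ 2).
      apply: le_trans (bessel_image _ _ _) _.
      by rewrite ler_wpM2l ?norm_family_sum// ler0c exprn_ge0// opnorm_ge0.
    apply: eq_bigr => a _; congr (`|_| ^+ 2); rewrite hdot_sumr.
    by apply: eq_bigr => i _; rewrite hdotZr mulrC.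
rewrite -subr_ge0.
apply: (@cvg_ge0C _ _ totally _ (fun G => ((opnorm X) ^+ 2 * K)%:C - f G)).
  by apply: nearW => G; rewrite subr_ge0.
apply: (@cvgB _ C^o); first exact: cvg_cst.
apply: (@cvg_big C^o _ +%R 0 xpredT) => [|i _]; first exact: add_continuous.
have pc := @proj_cvg (X (b (val i))).
apply: cvg_hdot => //; apply: (cvg_comp _ _ pc).
exact: bop_continuous.
Qed.

(** Apply [positive_amgm] to [X (b i)] and [c *: b i] with [c = opnorm X]: this weight makes both
    sums on the right at most [c ^+ 2 * K], and [2 * c] cancels. *)
Lemma diag_abs_bound X A :
  partial_sum (fun i => `|'[rho (X (b i)), b i]|) A <= (opnorm X * K)%:C.
Proof.
have K0 : 0 <= K.
  by rewrite -ler0c (le_trans _ (rhoK fset0))// sumr_ge0// => i _; exact: rho0.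
have [X0|X0] := eqVneq (opnorm X) 0.
  rewrite X0 mul0r /partial_sum big1// => i _.
  have := opnormP X (b (val i)); rewrite X0 mul0r normr_le0 => /eqP ->.
  by rewrite bop0 hdot0l normr0.
have Xgt0 : 0 < (opnorm X)%:C :> C by rewrite ltcR lt_def X0 opnorm_ge0.
pose c : C := (opnorm X)%:C.
rewrite -(ler_pM2l (x := 2 * c)) ?mulr_gt0//.
apply: (@le_trans _ _ (partial_sum (fun i => '[rho (X (b i)), X (b i)]) A +
    c ^+ 2 * partial_sum (fun i => '[rho (b i), b i]) A)).
  rewrite /partial_sum !mulr_sumr -big_split; apply: ler_sum => i _ /=.
  have := positive_amgm (X (b (val i))) (c *: b (val i)) rho0.
  rewrite bopZ hdotZl !hdotZr normrM.
  have -> : c^*%C = c by rewrite conjc_real.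
  by rewrite (ger0_norm (ltW Xgt0)) mulrA mulrA -expr2.
rewrite (le_trans (lerD (diag_image_bound _ _) (ler_wpM2l _ (rhoK _))))//.
  by rewrite exprn_ge0// ltW.
have -> : (opnorm X ^+ 2 * K)%:C = c ^+ 2 * K%:C by rewrite /c -rmorphXn -rmorphM.
have -> : (opnorm X * K)%:C = c * K%:C by rewrite /c -rmorphM.
rewrite (_ : _ + _ = 2 * c * (c * K%:C))//; ring.
Qed.

End TraceBound.

End ParsevalFamily.

(** * The trace of a density operator times a bounded operator *)

Section Trace.
Variables (R : realType) (H : hilbertType R).
Local Notation C := R[i].
Implicit Types (X Y : 'B(H)) (rho sigma : traceclass H).

(** Mirrors the restriction in [tr]: indexing by all of [H], with zero off the basis, makes the
    lemmas on families apply to the sum in [tr] as it stands. *)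
Definition padded_onb (e : H) : H := if e \in @onb R H then e else 0.
Local Notation b := padded_onb.

Lemma tr_padded X :
  tr X = lim (partial_sum (fun e => '[X (b e), b e] : C^o) @ totally).
Proof.
rewrite /tr /sum (_ : _ \_ _ = fun e => '[X (b e), b e])//; apply/funext => e.
by rewrite patchE /b; case: ifP => // _; rewrite hdot0r.
Qed.

Lemma tr_cvg X (l : C) :
  partial_sum (fun e => '[X (b e), b e] : C^o) @ totally --> (l : C^o) -> tr X = l.
Proof. by move=> Xl; rewrite tr_padded; exact: cvg_lim Xl. Qed.

(* If there were no orthonormal basis, [onb] would be empty and [tr] zero. *)
Lemma density_onb rho : density rho -> orthonormal_basis (@onb R H).
Proof.
case=> _ tr1; have : @onb R H <> set0.
  move=> D0; have : tr rho = 0.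
    apply: tr_cvg; rewrite (_ : partial_sum _ = cst 0); first exact: cvg_cst.
    apply/funext => A; rewrite /partial_sum big1// => e _.
    by rewrite /b D0 in_set0 hdot0r.
  by rewrite tr1; apply/eqP; exact: oner_neq0.
by rewrite /onb; case: xgetP.
Qed.

Section Basis.
Hypothesis onbP : orthonormal_basis (@onb R H).

Lemma padded_onb_orth e f : e != f -> '[b e, b f] = 0.
Proof.
rewrite /b; case: ifPn => [/set_mem De|_]; last by rewrite hdot0l.
case: ifPn => [/set_mem Df|_]; last by rewrite hdot0r.
by move=> ef; case: onbP => /(_ _ _ De Df) -> _; rewrite (negPf ef).
Qed.

Lemma padded_onb_unit e : '[b e, b e] *: b e = b e.
Proof.
rewrite /b; case: ifPn => [/set_mem De|_]; last by rewrite scaler0.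
by case: onbP => /(_ _ _ De De) -> _; rewrite eqxx scale1r.
Qed.

Lemma padded_onb_total u (e : C) : 0 < e ->
  exists n (a : 'I_n -> C) (k : 'I_n -> H), `|u - \sum_i a i *: b (k i)| < e.
Proof.
move=> e0; have : closure (lspan (@onb R H)) u by case: onbP => _ ->.
move=> /(_ (ball u e)) [|w [[n [a [v [Dv ->]]]]]]; first exact: nbhsx_ballx.
rewrite -ball_normE => uw; exists n, a, v.
rewrite [X in _ - X](_ : _ = \sum_i a i *: v i)//.
by apply: eq_bigr => i _; rewrite /b mem_set.
Qed.

Lemma rank_one_subproof x y : @is_bounded_op R H H (fun z => '[z, y] *: x).
Proof.
apply/asboolP; split=> [a u v|]; first by rewrite hdotDl hdotZl scalerDl scalerA.
exists (complex.Re (`|x| * `|y|)) => z.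
rewrite RRe_real ?ger0_real ?mulr_ge0// normrZ mulrC -mulrA.
by rewrite ler_wpM2l// mulrC cauchy_schwarz.
Qed.

Definition rank_one x y : 'B(H) := Bop (rank_one_subproof x y).

(** The diagonal entries are the terms of Parseval's identity for [X x] and [y]. *)
Lemma tr_rank_one X x y : tr (X * rank_one x y) = '[X x, y].
Proof.
apply: tr_cvg.
have := @parseval R H H b padded_onb_orth padded_onb_unit padded_onb_total (X x) y.
rewrite (_ : (fun i => _) = fun e => '[(X * rank_one x y) (b e), b e])//.
by apply/funext => e; rewrite [RHS]/= bopZ hdotZl mulrC.
Qed.

(** Rank-one test operators recover all matrix elements. This turns identities between traces into
    identities between states. *)
Lemma tr_separates X Y : (forall Z, tr (X * Z) = tr (Y * Z)) -> X = Y.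
Proof.
move=> XY; apply/val_inj/funext => x; apply: hdot_inj => y.
by rewrite -!tr_rank_one.
Qed.

End Basis.

Section Density.
Variable rho : traceclass H.
Hypothesis drho : density rho.

Lemma density_diag_le1 A : partial_sum (fun e => '[rho (b e), b e]) A <= (1 : R)%:C.
Proof.
case: drho => rho0 tr1.
(* A divergent diagonal would give [lim] its junk value 0. *)
have cv : partial_sum (fun e => '[rho (b e), b e] : C^o) @ totally --> (1 : C^o).
  rewrite -tr1 tr_padded; apply/cvg_ex; apply: contrapT => /cvg_ex dv.
  move: tr1; rewrite tr_padded dvgP// => /esym/eqP.
  by apply/negP; exact: oner_neq0.
(* The diagonal terms are nonnegative, so the partial sums increase and each lies below the limit
   1. *)
rewrite -subr_ge0.
apply: (@cvg_ge0C _ _ totally _ (fun B => partial_sum (fun e => '[rho (b e), b e]) B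
   - partial_sum (fun e => '[rho (b e), b e]) A)).
  by exists A => // B AB /=; rewrite subr_ge0 ler_partial_sum.
by apply: (@cvgB _ C^o); [exact: cv|exact: cvg_cst].
Qed.

(** [diag_abs_bound] with [K = 1] makes the diagonal absolutely summable, so that [tr] is here a
    true limit and not the default value of [lim]. *)
Lemma density_tr X :
  partial_sum (fun e => '[rho (X (b e)), b e] : C^o) @ totally -->
    (tr (tc_op rho * X) : C^o) /\ `|tr (tc_op rho * X)| <= (opnorm X)%:C.
Proof.
have D := density_onb drho; case: drho => rho0 _.
have := @diag_abs_bound _ _ _ _ (padded_onb_orth D) (padded_onb_unit D)
  (padded_onb_total D) _ _ rho0 density_diag_le1 X.
rewrite mulr1 => /abs_bounded_sum[l cl lX].
by rewrite (_ : tr _ = l)//; apply: tr_cvg.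
Qed.

Lemma density_tr_cvg X :
  partial_sum (fun e => '[rho (X (b e)), b e] : C^o) @ totally -->
    (tr (tc_op rho * X) : C^o).
Proof. by case: (density_tr X). Qed.

Lemma density_tr_bound X : `|tr (tc_op rho * X)| <= (opnorm X)%:C.
Proof. by case: (density_tr X). Qed.

Lemma density_tr_linear : linear (fun X => tr (tc_op rho * X) : C^o).
Proof.
move=> a X Y; apply: tr_cvg.
rewrite (_ : partial_sum _ = fun A =>
  a *: (partial_sum (fun e => '[rho (X (b e)), b e]) A : C^o) +
  partial_sum (fun e => '[rho (Y (b e)), b e]) A); last first.
  apply/funext => A; rewrite /partial_sum scaler_sumr -big_split.
  apply: eq_bigr => e _ /=.
  by rewrite bopD bopZ hdotDl hdotZl.
by apply: cvgD; [apply: cvgZr|]; exact: density_tr_cvg.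
Qed.

Lemma density_trB X Y :
  tr (tc_op rho * (X - Y)) = tr (tc_op rho * X) - tr (tc_op rho * Y).
Proof.
by rewrite [X - Y]addrC -scaleN1r [LHS](density_tr_linear (-1) Y X) scaleN1r addrC.
Qed.

Lemma density_trZ (a : C) X : tr (tc_op rho * (a *: X)) = a * tr (tc_op rho * X).
Proof.
have := density_tr_linear a X 0.
by rewrite -[in X in _ = _ + X](subrr X) density_trB subrr !addr0.
Qed.

(* Replaces cyclicity of the trace, as [tr (L V * rho)] is real on [C]. *)
Lemma tr_symmetric_density Y : (forall x y, '[Y x, y] = '[x, Y y]) ->
  tr (Y * tc_op rho) = (tr (tc_op rho * Y))^*%C.
Proof.
case: drho => rho0 _ Ysym; apply: tr_cvg.
rewrite (_ : partial_sum _ =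
  fun A => (partial_sum (fun e => '[rho (Y (b e)), b e]) A)^*%C); last first.
  apply/funext => A; rewrite /partial_sum rmorph_sum; apply: eq_bigr => e _.
  rewrite [LHS]Ysym positive_hermitian//; exact: hdotC.
have cv := density_tr_cvg (X := Y); move/cvgrPdist_lt : cv => cv.
apply/cvgrPdist_lt => e e0.
apply: filterS (cv _ e0) => A.
by rewrite -[in X in _ -> X](rmorphB (@conjc R)) normcJ.
Qed.

End Density.

Lemma trB_density rho sigma X : density rho -> density sigma ->
  tr ((tc_op rho - tc_op sigma) * X) = tr (tc_op rho * X) - tr (tc_op sigma * X).
Proof.
move=> drho dsigma; apply: tr_cvg.
rewrite (_ : partial_sum _ = fun A =>
  (partial_sum (fun e => '[rho (X (b e)), b e]) A : C^o) -
  partial_sum (fun e => '[sigma (X (b e)), b e]) A); last first.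
  apply/funext => A; rewrite /partial_sum -sumrB; apply: eq_bigr => e _ /=.
  by rewrite hdotBl.
by apply: cvgB; exact: density_tr_cvg.
Qed.

End Trace.

(** * The semigroup and its omega-limit sets *)

Section RealAndFilters.

(** The step size [d] is uniform in [t], so the interval is cut into [n] equal steps shorter than
    [d]; increments of slope at most [e / (t - s)] add up to at most [e]. *)
Lemma nonincreasing_upper_dini (R : realType) (f : R -> R) :
  (forall e, 0 < e -> exists2 d, 0 < d &
    forall t h, 0 <= t -> 0 < h < d -> f (t + h) <= f t + h * e) ->
  forall s t, 0 <= s -> s <= t -> f t <= f s.
Proof.
move=> fd s t s0; rewrite le_eqVlt => /predU1P[->//|st].
apply/ler_addgt0Pr => e e0.
have ts0 : 0 < t - s by rewrite subr_gt0.
have [d d0 df] := fd _ (divr_gt0 e0 ts0).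
pose n := (Num.truncn ((t - s) / d)).+1; pose h := (t - s) / n%:R.
have n0 : 0 < n%:R :> R by rewrite ltr0n.
have h0 : 0 < h by rewrite divr_gt0.
have hd : h < d.
  by rewrite ltr_pdivrMr// mulrC -ltr_pdivrMr// /n truncnS_gt.
have step m : f (s + m%:R * h) <= f s + m%:R * h * (e / (t - s)).
  elim: m => [|m IHm]; first by rewrite !mul0r !addr0.
  have -> : s + m.+1%:R * h = s + m%:R * h + h by rewrite -natr1; ring.
  have -> : m.+1%:R * h * (e / (t - s)) = m%:R * h * (e / (t - s)) + h * (e / (t - s)).
    by rewrite -natr1; ring.
  rewrite addrA (le_trans (df _ _ _ _)) ?h0// ?lerD2r//.
  by rewrite addr_ge0// mulr_ge0// ltW.
have := step n; rewrite /h [n%:R * _]mulrC divfK ?gt_eqF// subrKC.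
by rewrite mulrC divfK// gt_eqF.
Qed.

Lemma fmap_ultra (T U : Type) (f : T -> U) (F : set_system T) :
  UltraFilter F -> UltraFilter (f @ F).
Proof.
move=> FU; split=> [|G PG FG]; first exact: fmap_proper_filter.
apply/seteqP; split=> [A GA|//].
have [//|FnA] := in_ultra_setVsetC (f @^-1` A) FU.
have GnA : G (~` A) by exact: FG.
have : G (A `&` ~` A) by exact: filterI.
by rewrite setICr => /filter_not_empty.
Qed.

End RealAndFilters.

(** * Functionals vanishing on the range of a semigroup *)

Section BoundedFunctionals.
Variables (R : realType) (E : normedModType R[i]).
Local Notation C := R[i].
Implicit Types (T : R -> bop E E) (d : E -> C^o).

(** Since [d] vanishes on the range of [A], it equals its composition with [1 - A], so its norm is
    at most half of itself. *)
Lemma near_id_range_functional_eq0 (A : bop E E) d :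
  opnorm (1 - A) <= 2^-1 -> is_bounded_op d -> (forall x, d (A x) = 0) ->
  forall x, d x = 0.
Proof.
move=> A2 bd dA x; pose D : bop E C^o := Bop bd.
suff D0 : opnorm D <= 0.
  apply/eqP; rewrite -normr_le0 (le_trans (opnormP D x))//.
  by rewrite mulr_le0_ge0// lecR.
have Dh : opnorm D <= opnorm D * 2^-1.
  apply: opnorm_min; split=> [|y]; first by rewrite mulr_ge0 ?opnorm_ge0 ?invr_ge0.
  have -> : D y = D ((1 - A) y) by rewrite [RHS](bopB D) [D (A y)]dA subr0.
  rewrite (le_trans (opnormP D _))// rmorphM -mulrA ler_wpM2l ?ler0c ?opnorm_ge0//.
  by rewrite (le_trans (opnormP _ _))// ler_wpM2r// lecR.
have := Dh; rewrite -subr_le0 (_ : _ - _ = opnorm D * 2^-1).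
  by rewrite pmulr_lle0// invr_gt0.
by rewrite [X in X - _]splitr addrK.
Qed.

Lemma semigroup_range_functional_eq0 T d (t : R) :
  T 0 = 1 -> (forall s t, 0 <= s -> 0 <= t -> T (s + t) = T s * T t) ->
  {within `[0, +oo[, continuous T} -> is_bounded_op d -> 0 <= t ->
  (forall x, d (T t x) = 0) -> forall x, d x = 0.
Proof.
move=> T0 TD Tc bd t0 dT.
have [e e0 Te] : exists2 e, 0 < e & forall s, 0 <= s < e -> opnorm (1 - T s) <= 2^-1.
  have /subspace_continuousP/(_ 0) := Tc.
  rewrite /= in_itv /= lexx => /(_ isT)/cvgrPdist_lt/(_ (2^-1 : R)%:C).
  rewrite ltcR invr_gt0 ltr0n => /(_ isT) [e /= e0 Te]; exists e => // s /andP[s0 se].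
  have := Te s; rewrite /ball /= sub0r normrN ger0_norm// => /(_ se).
  rewrite in_itv /= s0 => /(_ isT) H1.
  have /ltW : `|T 0 - T s| < (2^-1)%:C by exact: H1.
  rewrite T0.
  by rewrite [X in X <= _ -> _](_ : _ = (opnorm (1 - T s))%:C)// lecR.
(* One factor [T s] is removed at a time: [d] composed with [T (n%:R * s)] is a bounded functional
   vanishing on the range of [T s]. *)
have key n s : 0 <= s -> s < e -> (forall x, d (T (n%:R * s) x) = 0) ->
    forall x, d x = 0.
  move=> s0 se; elim: n => [|n IHn] dTn.
    by move=> x; have := dTn x; rewrite mul0r T0.
  apply: IHn.
  apply: (@near_id_range_functional_eq0 (T s) (fun x => d (T (n%:R * s) x))).
  - by apply: Te; rewrite s0.
  - pose D : bop E C^o := Bop bd; apply/asboolP; split=> [a u v|].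
      by rewrite bop_linear [LHS](bop_linear D).
    exists (opnorm D * opnorm (T (n%:R * s))) => u.
    rewrite (le_trans (opnormP D _))// rmorphM -mulrA.
    by rewrite ler_wpM2l ?opnormP// ler0c opnorm_ge0.
  - move=> u; have := dTn u; rewrite -natr1 mulrDl mul1r TD//.
    by rewrite mulr_ge0.
pose n := (Num.truncn (t / e)).+1.
have n0 : 0 < n%:R :> R by rewrite ltr0n.
apply: (key n (t / n%:R)); first by rewrite divr_ge0.
  by rewrite ltr_pdivrMr// mulrC -ltr_pdivrMr// truncnS_gt.
by rewrite mulrC divfK// gt_eqF.
Qed.

End BoundedFunctionals.

(** * Symmetry of the generator's values *)

Section SymmetricOperators.
Variables (R : realType) (H : hilbertType R).
Local Notation C := R[i].
Implicit Types (V X : 'B(H)).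

Definition symmetric_op X := forall x y, '[X x, y] = '[x, X y].

(** If [xget] fell back to its default, [V] would be 0, which is symmetric as well. *)
Lemma selfadjoint_symmetric V : selfadjoint V -> symmetric_op V.
Proof.
rewrite /selfadjoint /adjoint; case: xgetP => [Y _ HY YV|_ <- x y].
  by rewrite YV in HY.
by rewrite hdot0l hdot0r.
Qed.

Lemma cp_positive (T : 'B(H) -> 'B(H)) X :
  completely_positive T -> positive_op X -> positive_op (T X).
Proof.
move=> /(_ 1 (fun _ _ => X)) cpT X0 x.
have := cpT _ (fun=> x); rewrite !big_ord1; apply => y.
by rewrite !big_ord1 (ord1 ord0).
Qed.

(** Adding [opnorm V] times the identity makes [V] positive; [T] keeps this sum and the identity
    positive, hence symmetric, and [T V] is a real combination of the two images. *)
Lemma cp_symmetric (T : bop 'B(H) 'B(H)) V :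
  completely_positive T -> symmetric_op V -> symmetric_op (T V).
Proof.
move=> cpT Vsym; pose c : C := (opnorm V)%:C.
have c0 : 0 <= c by rewrite ler0c opnorm_ge0.
have cC : c^*%C = c by rewrite conjc_real.
pose one : 'B(H) := 1.
have id0 : positive_op one by move=> x; exact: hdot_ge0.
have Vc0 : positive_op (V + c *: one).
  move=> x; rewrite [X in '[X, _]](_ : _ = V x + c *: x)// hdotDl hdotZl.
  have Vreal : '[V x, x] \is Num.real.
    by apply/CrealP; rewrite [RHS]Vsym; exact/esym/hdotC.
  rewrite -lerBlDl sub0r (le_trans (real_ler_norm _)) ?rpredN// normrN.
  rewrite (le_trans (cauchy_schwarz _ _))// hdot_norm expr2 mulrA.
  by rewrite ler_wpM2r// opnormP.
have TE : T V = T (V + c *: one) - c *: T one by rewrite bopD bopZ addrK.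
have S1 x y := positive_hermitian x y (cp_positive cpT Vc0).
have S2 x y := positive_hermitian x y (cp_positive cpT id0).
move=> x y; rewrite TE.
rewrite [LHS](hdotBl (T (V + c *: one) x) (c *: T one x)).
rewrite [RHS](hdotBr x (T (V + c *: one) y) (c *: T one y)).
by rewrite hdotZl hdotZr cC S1 S2.
Qed.

Lemma cvg_bop_eval (I : Type) (F : set_system I) {FF : Filter F}
    (X : I -> 'B(H)) (Y : 'B(H)) (x : H) :
  X @ F --> Y -> (X t : H -> H) x @[t --> F] --> (Y : H -> H) x.
Proof.
move=> /cvgrPdist_lt XY; apply/cvgrPdist_lt => e e0.
have c0 : 0 < `|x| + 1 by rewrite ltr_wpDl.
apply: filterS (XY _ (divr_gt0 e0 c0)) => t Xt.
rewrite (le_lt_trans (opnormP (Y - X t) x))//.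
rewrite (@le_lt_trans _ _ ((opnorm (Y - X t))%:C * (`|x| + 1)))//.
  by rewrite ler_wpM2l ?lerDl// ler0c opnorm_ge0.
by rewrite -ltr_pdivlMr.
Qed.

(** The difference quotients are symmetric, and symmetry passes to the limit. It serves to exchange
    the factors in the trace of [L V] with a state. *)
Lemma generator_symmetric (T : R -> bop 'B(H) 'B(H)) L V :
  (forall t, 0 <= t -> completely_positive (T t)) -> is_generator T L ->
  symmetric_op V -> symmetric_op (L V).
Proof.
move=> cpT /(_ V) TL Vsym x y.
pose D t : 'B(H) := (t^-1)%:C *: (T t V - V).
have l1 : ('[D t x, y] : C^o) @[t --> 0^'+] --> ('[L V x, y] : C^o).
  by apply: cvg_hdot; [exact: cvg_bop_eval TL|exact: cvg_cst].
have l2 : ('[x, D t y] : C^o) @[t --> 0^'+] --> ('[x, L V y] : C^o).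
  by apply: cvg_hdot; [exact: cvg_cst|exact: cvg_bop_eval TL].
suff l1' : ('[D t x, y] : C^o) @[t --> 0^'+] --> ('[x, L V y] : C^o).
  exact: (cvg_unique (@norm_hausdorff _ C^o) l1 l1').
apply: cvg_trans l2; apply: near_eq_cvg; near=> t.
have t0 : 0 <= t by apply: ltW; near: t; exact: nbhs_right_gt.
have TV := cp_symmetric (cpT _ t0) Vsym.
change ('[x, (t^-1)%:C *: (T t V y - V y)] =
  '[(t^-1)%:C *: (T t V x - V x), y]).
by rewrite hdotZl hdotZr conjc_real hdotBl hdotBr TV Vsym.
Unshelve. all: by end_near. Qed.

End SymmetricOperators.

(** * Weak convergence and compactness through filters *)

Section WeakTopology.
Variables (R : realType) (H : hilbertType R).
Local Notation C := R[i].

Lemma weak_cvg_tr (F : set_system (weak_traceclass H)) (FF : Filter F)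
    (sigma : traceclass H) (A : 'B(H)) :
  F --> (sigma : weak_traceclass H) ->
  (tr (tc_op rho * A) : C^o) @[rho --> F] --> (tr (tc_op sigma * A) : C^o).
Proof.
move=> Fs; pose f (rho : traceclass H) : {ptws 'B(H) -> C^o} :=
  fun A => tr (tc_op rho * A).
have cf : {for (sigma : weak_traceclass H), continuous (f : weak_traceclass H -> _)}.
  exact: initial_continuous.
have := @proj_continuous 'B(H) (fun=> C^o) A (f sigma).
by move=> cA; apply: (cvg_comp _ _ (cvg_comp _ _ Fs cf) cA).
Qed.

(** A finer filter plays the role of a subnet: extend [F] to an ultrafilter, whose image under [g]
    is an ultrafilter containing [K] and so converges in [K]. *)
Lemma weakly_compact_subnet (T : Type) (F : set_system T) (g : T -> traceclass H)
    (K : set (traceclass H)) :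
  ProperFilter F -> weakly_compact K -> (\forall t \near F, K (g t)) ->
  exists G sigma, [/\ ProperFilter G, F `<=` G, K sigma &
    forall A, (tr (tc_op (g t) * A) : C^o) @[t --> G] -->
      (tr (tc_op sigma * A) : C^o)].
Proof.
move=> FF; rewrite /weakly_compact compact_ultra => Kc Fg.
have [G [GU FG]] := ultraFilterLemma FF.
have gU := fmap_ultra (g : T -> weak_traceclass H) GU.
have [sigma [Ks Gs]] := Kc _ gU (FG _ Fg).
exists G, sigma; split=> //; first exact: ultra_proper.
move=> A.
have PG : ProperFilter G by exact: ultra_proper.
exact: (@weak_cvg_tr ((g : T -> weak_traceclass H) @ G) _ sigma A Gs).
Qed.

End WeakTopology.

(** * Invariance and attraction of the omega-limit set *)

Section LaSalle.
Variables (R : realType) (H : hilbertType R).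
Variables (T : R -> bop 'B(H) 'B(H)) (L : 'B(H) -> 'B(H)).
Variables (S : R -> traceclass H -> traceclass H) (V : 'B(H)).
Variable K : set (traceclass H).
Implicit Types (rho sigma w : traceclass H) (A : 'B(H)).

Hypothesis T0 : T 0 = 1.
Hypothesis TD : forall s t, 0 <= s -> 0 <= t -> T (s + t) = T s * T t.
Hypothesis Tcont : uniformly_continuous_qds T.
Hypothesis TL : is_generator T L.
Hypothesis TS : is_predual T S.
Hypothesis K_invariant : invariant_set S K.
Hypothesis K_compact : weakly_compact K.
Hypothesis LV_symmetric : symmetric_op (L V).
Hypothesis LV_le0 : forall rho, K rho -> tr (L V * tc_op rho) <= 0.

Let K_density rho : K rho -> density rho.
Proof. by case: K_invariant => KD _; exact: KD. Qed.

(** The semigroup law of [S], in the weak form given by duality with [T]. *)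
Lemma predual_shift rho s t A : 0 <= s -> 0 <= t ->
  tr (tc_op (S (t + s) rho) * A) = tr (tc_op (S t rho) * T s A).
Proof. by move=> s0 t0; rewrite -!TS// ?addr_ge0// TD. Qed.

Lemma predual0 rho : density rho -> S 0 rho = rho.
Proof.
move=> drho; apply: val_inj; apply: (tr_separates (density_onb drho)) => A.
by rewrite -TS// T0.
Qed.

Lemma predual_inj rho sigma t : density rho -> density sigma -> 0 <= t ->
  S t rho = S t sigma -> rho = sigma.
Proof.
move=> drho dsigma t0 St; apply: val_inj.
apply: (tr_separates (density_onb drho)) => A; apply/eqP; rewrite -subr_eq0; apply/eqP.
(* By duality [d] vanishes on the range of [T t] when the two images under [S t] agree. *)
pose d (X : 'B(H)) : R[i]^o := tr (tc_op rho * X) - tr (tc_op sigma * X).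
apply: (@semigroup_range_functional_eq0 R 'B(H) T d t T0 TD Tcont _ t0) => [|X].
  apply/asboolP; split=> [a X Y|].
    by rewrite /d !density_tr_linear// scalerBr opprD addrACA.
  exists 2 => X; rewrite (le_trans (ler_normB _ _))//.
  rewrite (le_trans (lerD (density_tr_bound drho X) (density_tr_bound dsigma X)))//.
  by rewrite rmorph_nat mulr_natl mulr2n.
by rewrite /d !TS// St subrr.
Qed.

Lemma predual_stays rho t : K rho -> 0 <= t -> K (S t rho).
Proof.
move=> Krho t0; case: K_invariant => _ /(_ rho 0); apply => //.
  exact: K_density.
by rewrite predual0//; exact: K_density.
Qed.

(** The two sides are conjugate to each other, and the right one is real because it is comparable to
    0. *)
Lemma tr_LV rho : K rho -> tr (tc_op rho * L V) = tr (L V * tc_op rho).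
Proof.
move=> Krho; have := LV_le0 Krho.
rewrite (tr_symmetric_density (K_density Krho) LV_symmetric) => le0.
by rewrite -[LHS]conjcK; exact/CrealP/ler0_real.
Qed.

(** The quotients converge in operator norm and states have norm at most 1 as functionals, so [d]
    can be chosen before [rho]. This gives the uniform step size that [lyapunov_decreasing] requires
    along the orbit. *)
Lemma generator_expansion (e : R) : 0 < e -> exists2 d, 0 < d &
  forall rho h, density rho -> 0 < h < d ->
    `|tr (tc_op rho * (T h V - V)) - h%:C * tr (tc_op rho * L V)| <= (h * e)%:C.
Proof.
move=> e0; have eC : 0 < e%:C :> R[i] by rewrite ltcR.
have TLV := @TL V; move/cvgrPdist_le : TLV => /(_ _ eC)[d /= d0 de].
exists d => // rho h drho /andP[h0 hd].
have := de h; rewrite /ball /= sub0r normrN gtr0_norm// => /(_ hd h0) dist.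
set D := (L V - _) in dist.
have -> : T h V - V = h%:C *: L V - h%:C *: D.
  by rewrite -scalerBr /D subKr scalerA -rmorphM mulfV ?gt_eqF// scale1r.
rewrite density_trB// !density_trZ// addrAC subrr add0r normrN normrM rmorphM.
rewrite ger0_norm ?ler0c ?(ltW h0)// ler_wpM2l ?ler0c ?(ltW h0)//.
exact: le_trans (density_tr_bound drho D) dist.
Qed.

Lemma lyapunov_decreasing rho s t : K rho -> 0 <= s -> s <= t ->
  complex.Re (tr (tc_op (S t rho) * V)) <= complex.Re (tr (tc_op (S s rho) * V)).
Proof.
move=> Krho; move: s t.
apply: (@nonincreasing_upper_dini R (fun t => complex.Re (tr (tc_op (S t rho) * V)))).
move=> e e0; have [d d0 de] := generator_expansion e0; exists d => // t h t0 hd.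
have [h0 _] := andP hd.
have KS := predual_stays Krho t0; have dS := K_density KS.
rewrite predual_shift ?(ltW h0)//.
have := de _ _ dS hd; rewrite density_trB// tr_LV// => le.
have := le_trans (normc_ge_Re _) le; rewrite lecR => /(le_trans (ler_norm _)).
rewrite !raddfB /= lerBlDr lerBlDr => /le_trans; apply.
rewrite [leRHS]addrC lerD2r gerDl.
have : h%:C * tr (L V * tc_op (S t rho)) <= 0.
  by rewrite mulr_ge0_le0 ?ler0c ?(ltW h0)// LV_le0.
by rewrite lecE => /andP[].
Qed.

(* Weak cluster points of the orbit at infinity, each with a filter along which
   the orbit converges to it; the same filters can be shifted in time. *)
Definition omega_limit rho : set (traceclass H) := [set w | K w /\
  exists F : set_system R, [/\ ProperFilter F, pinfty_nbhs R `<=` F &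
    forall A, (tr (tc_op (S t rho) * A) : R[i]^o) @[t --> F] -->
      (tr (tc_op w * A) : R[i]^o)]].

Let pinfty_shift (F : set_system R) (s : R) : Filter F -> pinfty_nbhs R `<=` F ->
  pinfty_nbhs R `<=` (fun t => t + s) @ F.
Proof.
move=> FF Foo P [M [Mr MP]]; apply: Foo; exists (M - s); split.
  exact: num_real.
by move=> x Mx; apply: MP; rewrite -ltrBlDr.
Qed.

Let pinfty_ge0 (F : set_system R) (s : R) : pinfty_nbhs R `<=` F ->
  F [set t | s <= t].
Proof.
by apply; exists s; split; [exact: num_real|move=> x /ltW].
Qed.

Lemma omega_stays rho w s : omega_limit rho w -> 0 <= s ->
  omega_limit rho (S s w).
Proof.
move=> [Kw [F [PF Foo Fw]]] s0; split; first exact: predual_stays.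
exists ((fun t => t + s) @ F); split; first exact: fmap_proper_filter.
  exact: pinfty_shift.
move=> A; rewrite -TS//.
suff : (tr (tc_op (S (t + s) rho) * A) : R[i]^o) @[t --> F] -->
    (tr (tc_op w * T s A) : R[i]^o) by [].
apply: cvg_trans (Fw (T s A)).
apply: near_eq_cvg; apply: filterS (pinfty_ge0 0 Foo) => t t0.
by rewrite predual_shift.
Qed.

(** Take [w'] as a cluster point of the orbit delayed by [s], along a filter finer than the one
    defining [w]; applying [S s] gives back the limit [w]. *)
Lemma omega_preimage rho w s : K rho -> omega_limit rho w -> 0 <= s ->
  exists2 w', omega_limit rho w' & S s w' = w.
Proof.
move=> Krho [Kw [F [PF Foo Fw]]] s0.
have FK : \forall t \near F, K (S (t - s) rho).
  apply: filterS (pinfty_ge0 s Foo) => t st.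
  by apply: predual_stays; rewrite ?subr_ge0.
have [G [w' [PG FG Kw' Gw']]] := weakly_compact_subnet PF K_compact FK.
have Goo := subset_trans Foo FG.
exists w'.
  split=> //; exists ((fun t => t - s) @ G).
  by split=> //; [exact: fmap_proper_filter|exact: pinfty_shift].
apply: val_inj; apply: (tr_separates (density_onb (K_density Kw))) => A.
rewrite -TS//.
have GwA : (tr (tc_op (S t rho) * A) : R[i]^o) @[t --> G] --> (tr (tc_op w * A) : R[i]^o).
  by apply: cvg_trans (Fw A); exact: cvg_app.
apply: (cvg_unique (@norm_hausdorff _ R[i]^o) _ GwA).
apply: cvg_trans (Gw' (T s A)).
apply: near_eq_cvg; apply: filterS (pinfty_ge0 s Goo) => t st.
by rewrite -predual_shift ?subr_ge0// subrK.
Qed.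

(** The state [sigma] is an arbitrary density: [omega_preimage] gives some [w'] in the limit set
    with the same image under [S t], and injectivity identifies [sigma] with [w']. *)
Lemma omega_two_side_invariant rho : K rho ->
  two_side_invariant S (omega_limit rho).
Proof.
move=> Krho; split=> [w [Kw _]|sigma t dsigma t0 wS t' t'0]; first exact: K_density.
apply: (omega_stays _ t'0).
have [w' ww' Sw'] := omega_preimage Krho wS t0.
have Kw' : K w' by case: ww'.
by rewrite -(predual_inj (K_density Kw') dsigma t0 Sw').
Qed.

(** An iterated limit: for fixed [s], letting [t] run along [F] puts the value at [w1] below that at
    time [s]; then [s] runs along [G]. Exchanging [w1] and [w2] gives equality. *)
Lemma omega_lyapunov_constant rho w1 w2 : K rho ->
  omega_limit rho w1 -> omega_limit rho w2 ->
  complex.Re (tr (tc_op w1 * V)) = complex.Re (tr (tc_op w2 * V)).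
Proof.
move=> Krho; wlog suff : w1 w2 / omega_limit rho w1 -> omega_limit rho w2 ->
    complex.Re (tr (tc_op w1 * V)) <= complex.Re (tr (tc_op w2 * V)).
  by move=> le ww1 ww2; apply/eqP; rewrite eq_le !le.
move=> [_ [F [PF Foo /(_ V) Fw]]] [_ [G [PG Goo /(_ V) Gw]]].
apply: (cvgr_to_ge (cvg_Re Gw)); apply: filterS (pinfty_ge0 0 Goo) => s s0.
apply: (cvgr_to_le (cvg_Re Fw)); apply: filterS (pinfty_ge0 s Foo) => t st.
exact: lyapunov_decreasing.
Qed.

Lemma omega_LV0 rho w : K rho -> omega_limit rho w -> tr (L V * tc_op w) = 0.
Proof.
move=> Krho ww; have Kw : K w by case: ww.
have dw := K_density Kw.
have := LV_le0 Kw; rewrite -tr_LV//; set z := tr _ => z0.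
suff Rez : complex.Re z = 0.
  move: z0; rewrite lecE => /andP[/eqP Imz _].
  by apply/eqP; rewrite eq_complex Rez -Imz !eqxx.
apply/eqP; rewrite -normr_le0; apply/ler_addgt0Pr => e e0; rewrite add0r.
have [d d0 de] := generator_expansion e0.
have h0 : 0 < d / 2 by rewrite divr_gt0.
have hd : 0 < d / 2 < d by rewrite h0 ltr_pdivrMr// ltr_pMr// ltr1n.
have := de _ _ dw hd; set h := d / 2 in h0 hd *.
(* Both [w] and [S h w] lie in the limit set, so the increment of [V] cancels and only [h] times the
   real part of [z] remains, bounded by [h * e]. *)
move=> /(le_trans (normc_ge_Re _)); rewrite lecR density_trB// !raddfB /=.
rewrite TS ?(ltW h0)// (omega_lyapunov_constant Krho (omega_stays ww (ltW h0)) ww).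
rewrite subrr sub0r normrN -/z.
have -> : complex.Re (h%:C * z) = h * complex.Re z.
  by case: z {z0} => a b /=; rewrite mul0r subr0.
by rewrite normrM gtr0_norm// ler_pM2l.
Qed.

Lemma omega_attracts rho (M : set (traceclass H)) A : K rho ->
  omega_limit rho `<=` M ->
  ereal_inf [set (complex.Re `|tr ((tc_op (S t rho) - tc_op sigma) * A)|)%:E
            | sigma in M] @[t --> +oo] --> 0%E.
Proof.
move=> Krho wM.
have Foo : ProperFilter (pinfty_nbhs R) by exact: proper_pinfty_nbhs.
pose X t := [set (complex.Re `|tr ((tc_op (S t rho) - tc_op sigma) * A)|)%:E
              | sigma in M].
rewrite -/(X _).
have X0 t : (0%E <= ereal_inf (X t))%E.
  apply/ereal_infP => _ [sigma Ms <-].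
  by rewrite lee_fin -ler0c RRe_real ?normr_real.
have near0 e : 0 < e -> \forall t \near +oo_R, (ereal_inf (X t) <= e%:E)%E.
  move=> e0; apply: contrapT => ninf.
  pose B := [set t : R | ~ (ereal_inf (X t) <= e%:E)%E].
  (* If the claim fails, the bad times [B] are unbounded, so the filter at infinity restricted to
     [B] is proper. A cluster point [w] along it lies in [M], which forces the infimum below [e] at
     some bad time. *)
  have PB : ProperFilter (within B (pinfty_nbhs R)).
    apply: Build_ProperFilter_ex => P BP; apply: contrapT => nP; apply: ninf.
    have {}BP : \forall t \near +oo_R, B t -> P t by exact: BP.
    apply: filterS BP => t BPt; apply: contrapT => Bt; apply: nP.
    by exists t; exact: BPt.
  have BK : \forall t \near within B (pinfty_nbhs R), K (S t rho).
    exists 0; split=> // t t0 _; exact/predual_stays/ltW.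
  have [G [w [PG FG Kw Gw]]] := weakly_compact_subnet PB K_compact BK.
  have Goo : pinfty_nbhs R `<=` G.
    by move=> P oP; apply: FG; apply: filterS oP => t Pt _.
  have Mw : M w by apply: wM; split=> //; exists G.
  have eC : 0 < e%:C :> R[i] by rewrite ltcR.
  have GB : G B by apply: FG; exact: withinT.
  have GwA := Gw A; move/cvgrPdist_lt : GwA => /(_ _ eC) GD.
  have [t [[Bt /= Dt] /= t0]] := filter_ex (filterI (filterI GB GD) (pinfty_ge0 0 Goo)).
  apply: Bt.
  apply: (@le_trans _ _ (complex.Re `|tr ((tc_op (S t rho) - tc_op w) * A)|)%:E).
    by apply: ereal_inf_lbound; exists w.
  rewrite lee_fin -lecR RRe_real ?normr_real// ltW// trB_density.
  - by rewrite distrC.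
  - exact/K_density/predual_stays.
  - exact: K_density.
(* The infimum would be infinite for empty [M]; the bound [near0] rules this out at large times. *)
apply/fine_cvgP; split.
  apply: filterS (near0 1 ltr01) => t t1.
  by rewrite ge0_fin_numE; [exact: le_lt_trans t1 (ltry _)|exact: X0].
apply/cvgrPdist_le => e e0; apply: filterS (near0 e e0) => t te.
rewrite sub0r normrN ger0_norm; last exact/fine_ge0/X0.
rewrite -lee_fin fineK//.
by rewrite ge0_fin_numE; [exact: le_lt_trans te (ltry _)|exact: X0].
Qed.

End LaSalle.

Theorem theorem19 (R : realType) (H K Gamma HGamma : hilbertType R)
  (fock : fock_space K Gamma) (tp : tensor_product H Gamma HGamma)
  (U : R -> 'B(HGamma)) (Psi : traceclass Gamma) (E0 : 'B(HGamma) -> 'B(H))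
  (T : R -> bop 'B(H) 'B(H)) (L : 'B(H) -> 'B(H))
  (S : R -> traceclass H -> traceclass H)
  (hU : forall t, 0 <= t -> unitary_op (U t))
  (hPsi : density Psi)
  (hE0 : is_cond_expectation tp Psi E0)
  (hT : is_qds T)
  (hTcont : uniformly_continuous_qds T)
  (hTU : is_dilation tp U E0 T)
  (hL : is_generator T L)
  (hS : is_predual T S)
  (hSU : is_dilated_predual tp U Psi S)
  (V : 'B(H)) (hV : selfadjoint V)
  (N : set (traceclass H)) (hN : is_neighborhood N)
  (hVN : forall rho, N rho -> tr (L V * tc_op rho) <= 0)
  (C : set (traceclass H)) (hCN : C `<=` N)
  (hCcompact : weakly_compact C) (hCinv : invariant_set S C)
  (M : set (traceclass H))
  (hM : largest_two_side_invariant_in S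
          [set rho | C rho /\ tr (L V * tc_op rho) = 0] M) :
  forall rho, C rho -> forall A : 'B(H),
    ereal_inf [set (complex.Re `|tr ((tc_op (S t rho) - tc_op sigma) * A)|)%:E
              | sigma in M] @[t --> +oo] --> 0%E.
Proof.
have [T0 TD Tcp _] := hT.
have LV_sym := generator_symmetric Tcp hL (selfadjoint_symmetric hV).
have LV_le0 rho : C rho -> tr (L V * tc_op rho) <= 0 by move/hCN/hVN.
move=> rho Crho A; case: hM => _ _ M_max.
have omega_M : omega_limit S C rho `<=` M.
  apply: M_max; last exact: (omega_two_side_invariant T0 TD hTcont hS hCinv hCcompact).
  move=> w ww; split; first by case: ww.
  exact: (omega_LV0 T0 TD hL hS hCinv LV_sym LV_le0 Crho ww).
exact (omega_attracts T0 hS hCinv hCcompact A Crho omega_M).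
Qed.
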